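(* Let $G$ be a connected triangle-free plane graph whose outer face is bounded by a cycle $C$ of length $k\ge 6$, and suppose that all internal faces of $G$ have length $4$. Then $G$ is $C$-critical (for $3$-coloring) if and only if $G$ contains no separating $4$-cycles.
   Context: Graphs may have parallel edges; triangle-free graphs have no loops and no $3$-cycles. Internal faces are the faces other than the outer face. For a graph $G$ and a proper subgraph $C$, $G$ is $C$-critical (for $3$-coloring) if for every proper subgraph $H\subsetneq G$ with $C\subseteq H$ there exists a proper $3$-coloring of $C$ that extends to a proper $3$-coloring of $H$ but not to one of $G$. A separating cycle is a cycle of $G$ that does not bound a face of $G$. *)

(* Defs.v *)
From HB Require Import structures.
From mathcomp Require Import all_boot all_fingroup.

Set Implicit Arguments.
Unset Strict Implicit.
Unset Printing Implicit Defensive.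

(* Finite multigraphs: each edge is a pair {d, flip d} of opposite darts, and
   d is the edge directed from [src d] to [src (flip d)].  Loops and parallel
   edges are allowed. *)
Record mgraph := MGraph {
  vertex : finType;
  dart : finType;
  src : dart -> vertex;
  flip : {perm dart};
  flipK : involutive flip;
  flip_neq : forall d, flip d != d
}.

Definition dst (G : mgraph) (d : dart G) : vertex G := src (flip G d).

Definition adj (G : mgraph) : rel (vertex G) :=
  fun u v => [exists d : dart G, (src d == u) && (dst d == v)].

Definition connected (G : mgraph) : Prop :=
  forall u v : vertex G, connect (@adj G) u v.

(* The second component of a subgraph contains both darts of each edge. *)
Definition subgraph (G : mgraph) : Type :=
  ({set vertex G} * {set dart G})%type.

Definition is_subgraph (G : mgraph) (H : subgraph G) : Prop :=
  forall d : dart G, d \in H.2 -> src d \in H.1 /\ flip G d \in H.2.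

Definition whole (G : mgraph) : subgraph G := ([set: vertex G], [set: dart G]).

Definition subgraph_le (G : mgraph) (H K : subgraph G) : Prop :=
  H.1 \subset K.1 /\ H.2 \subset K.2.

Definition proper_subgraph (G : mgraph) (H : subgraph G) : Prop :=
  is_subgraph H /\ H <> whole G.

(* The last clause makes the edges distinct; it only matters for closed walks
   of length 2, excluding the traversal of one edge back and forth. *)
Definition is_cycle (G : mgraph) (c : seq (dart G)) : Prop :=
  [/\ c <> [::],
      path.cycle (fun d d' : dart G => dst d == src d') c,
      uniq (map (@src G) c)
    & forall d : dart G, d \in c -> flip G d \notin c].

Definition cycle_subgraph (G : mgraph) (c : seq (dart G)) : subgraph G :=
  ([set v | v \in map (@src G) c], [set d | (d \in c) || (flip G d \in c)]).

Definition triangle_free (G : mgraph) : Prop :=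
  (forall d : dart G, src d <> dst d) /\
  (forall c : seq (dart G), is_cycle c -> size c <> 3).

(* A coloring of a subgraph is represented by a map on all vertices of the
   ambient graph, whose values outside the subgraph are irrelevant. *)
Definition proper_coloring (G : mgraph) (H : subgraph G)
    (phi : vertex G -> 'I_3) : Prop :=
  forall d : dart G, d \in H.2 -> phi (src d) <> phi (dst d).

Definition extends_to (G : mgraph) (C : subgraph G) (phi : vertex G -> 'I_3)
    (H : subgraph G) : Prop :=
  exists psi : vertex G -> 'I_3,
    proper_coloring H psi /\ (forall v, v \in C.1 -> psi v = phi v).

Definition critical (G : mgraph) (C : subgraph G) : Prop :=
  proper_subgraph C /\
  forall H : subgraph G, proper_subgraph H -> subgraph_le C H ->
    exists phi : vertex G -> 'I_3,
      [/\ proper_coloring C phi, extends_to C phi H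
        & ~ extends_to C phi (whole G)].

(* The face permutation of a rotation system: the orbit of d is the boundary
   walk of the face on a fixed side of d. *)
Definition face_perm (G : mgraph) (rotn : {perm (dart G)}) : {perm (dart G)} :=
  (flip G * rotn)%g.

(* A connected plane graph with at least one edge, up to homeomorphism of the
   plane: a rotation system (the cyclic order of the darts leaving each
   vertex) of genus 0, by Euler's formula, and a choice of outer face.  Faces
   are orbits of the face permutation; this is correct for connected graphs
   only, hence the connectedness field. *)
Record connected_plane_graph := ConnectedPlaneGraph {
  pgraph :> mgraph;
  rotation : {perm (dart pgraph)};
  rotationP : forall d : dart pgraph,
    porbit rotation d = [set d' | src d' == src d];
  pgraph_connected : connected pgraph;
  pgraph_euler :
    #|vertex pgraph| + #|porbits (face_perm rotation)|
      = #|dart pgraph|./2 + 2;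
  outer_face : {set dart pgraph};
  outer_faceP : outer_face \in porbits (face_perm rotation)
}.

Definition faces (G : connected_plane_graph) : {set {set dart G}} :=
  porbits (face_perm (rotation G)).

(* Each dart lies on one boundary walk, so an edge with the same face on both
   sides counts twice. *)
Definition face_length (G : connected_plane_graph) (F : {set dart G}) : nat :=
  #|F|.

Definition face_boundary (G : connected_plane_graph) (F : {set dart G}) :
    subgraph G :=
  ([set src d | d in F], [set d | (d \in F) || (flip G d \in F)]).

Definition bounds (G : connected_plane_graph) (c : seq (dart G))
    (F : {set dart G}) : Prop :=
  face_boundary F = cycle_subgraph c.

Definition separating_cycle (G : connected_plane_graph) (c : seq (dart G)) :
    Prop :=
  is_cycle c /\ ~ (exists2 F, F \in faces G & bounds c F).

(* Main.v *)
(* By Euler's formula, the incidence matrices of vertices and of faces over F_2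
   have complementary ranks, so cocycles are coboundaries (hence G is bipartite)
   and cycles bound (hence every simple cycle is, up to sign, the boundary of a
   unique set of internal faces, its inside).

   If K is a separating 4-cycle, pick an edge e strictly inside K. A 3-coloring
   of G - e gives two opposite vertices of K the same color, so the inside of K
   can be recolored with two colors following the bipartition: e is useless.

   Conversely, without separating 4-cycles there are no parallel edges, so every
   cycle of G - e with e strictly inside has length at least 6. For an edge e not
   in C take a unit flow delta in the dual from a face at e to the outer face.
   The length bound says that the weights 1 - 6 delta have no negative cycle on
   G - e, so they admit a potential g; chosen compatibly with the bipartition, it
   makes dg + 6 delta equal to 1 or -1 on every dart of G - e. Thus g mod 3
   colors G - e, with total winding -6 around the outer face. A 3-coloring of G
   has winding 0 around each 4-face, hence around C, so no coloring of G agrees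
   with g mod 3 on C. *)
Require Import Defs.
From mathcomp Require Import all_boot all_order all_algebra all_fingroup zify ring.

Set Implicit Arguments.
Unset Strict Implicit.
Unset Printing Implicit Defensive.

Import Order.TTheory GRing.Theory.

(** * Exactness over F_2 *)

(** Orthogonality puts the row space of [A] inside the kernel of [B^T], whose dimension
    [n - \rank B] is at most [\rank A]; so the two spaces coincide. *)
Lemma exact_of_rank (F : fieldType) m n p (A : 'M[F]_(m, n)) (B : 'M[F]_(p, n)) :
  (A *m B^T = 0)%R -> n <= \rank A + \rank B ->
  forall x : 'rV[F]_n, (x *m B^T = 0)%R -> (x <= A)%MS.
Proof.
move=> AB0 rkAB x /sub_kermxP xB0; apply: submx_trans xB0 _.
have /sub_kermxP sAB := AB0.
rewrite -(mxrank_leqif_sup sAB).2 eqn_leq (mxrankS sAB) /=.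
by rewrite mxrank_ker mxrank_tr leq_subLR addnC.
Qed.

Lemma F2_add_eq0 (x y : 'F_2) : (x + y = 0)%R -> x = y.
Proof. by move=> /eqP; rewrite addr_eq0 oppr_pchar2 // => /eqP. Qed.

Lemma natr_F2_odd n : (n%:R = (odd n)%:R :> 'F_2)%R.
Proof. by apply: val_inj; rewrite /= !val_Fp_nat // !modn2; case: odd. Qed.

Lemma F2_bool (x : 'F_2) : x = ((x == 1)%R%:R)%R.
Proof. by case: x => [[|[|//]]] ?; apply: val_inj. Qed.

(** * Incidence matrices of the orbits of a rotation system *)

Section Orbits.

Variables (D : finType) (fl : {perm D}).
Hypotheses (flK : involutive fl) (fl_neq : forall d, fl d != d).

(** Enumeration order selects one dart per edge, so that matrix columns correspond to edges. *)
Definition edge_reps : {set D} := [set d | enum_rank d < enum_rank (fl d)].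

Lemma edge_reps_flip d : (fl d \in edge_reps) = (d \notin edge_reps).
Proof.
rewrite !inE flK -leqNgt [RHS]leq_eqVlt.
by rewrite (inj_eq (@ord_inj _)) (inj_eq enum_rank_inj) (negPf (fl_neq d)).
Qed.

Lemma card_edge_reps : #|D| = #|edge_reps|.*2.
Proof.
rewrite -cardsT -(cardsID edge_reps) setTI setTD -addnn; congr (_ + _).
suff ->: ~: edge_reps = fl @: edge_reps by rewrite card_imset //; exact: perm_inj.
apply/setP=> d; rewrite in_setC -edge_reps_flip; apply/idP/imsetP => [dE|[x xE ->]].
  by exists (fl d); rewrite ?flK.
by rewrite flK.
Qed.

Lemma sum_edge_reps (g : D -> 'F_2) :
  (\sum_(j < #|edge_reps|) (g (enum_val j) + g (fl (enum_val j))) = \sum_d g d)%R.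
Proof.
rewrite (bigID [in edge_reps] predT) /=.
rewrite [X in (_ + X)%R](reindex_inj (perm_inj (s := fl))) /=.
rewrite [X in (_ + X)%R](eq_bigl [in edge_reps]); last first.
  by move=> d; rewrite edge_reps_flip negbK.
by rewrite -big_split /= [RHS]big_enum_val.
Qed.

(** For the rotation this is the vertex-edge incidence matrix, for the face permutation the
    face-edge one. An edge with both darts in one orbit contributes 0, as a loop should. *)
Definition incidence (s : {perm D}) : 'M['F_2]_(#|porbits s|, #|edge_reps|) :=
  (\matrix_(i < #|porbits s|, j < #|edge_reps|) ((enum_val j \in enum_val i)%:R +
                   (fl (enum_val j) \in enum_val i)%:R))%R.

Lemma porbit_in_porbits (s : {perm D}) d : porbit s d \in porbits s.
Proof. exact: imset_f. Qed.

Definition orbit_index (s : {perm D}) (d : D) : 'I_#|porbits s| :=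
  enum_rank_in (porbit_in_porbits s d) (porbit s d).

Lemma orbit_indexK s d : enum_val (orbit_index s d) = porbit s d.
Proof. by rewrite enum_rankK_in // porbit_in_porbits. Qed.

Lemma mem_orbit_index s d (i : 'I_#|porbits s|) : (d \in enum_val i) = (i == orbit_index s d).
Proof.
apply/idP/eqP => [|->]; last by rewrite orbit_indexK porbit_id.
have /imsetP[x _ ix] := enum_valP i.
rewrite ix -eq_porbit_mem => /eqP xd.
by apply: enum_val_inj; rewrite orbit_indexK ix xd.
Qed.

Lemma orbit_index_next s d : orbit_index s (s d) = orbit_index s d.
Proof.
apply: enum_val_inj; rewrite !orbit_indexK; apply/eqP.
by rewrite eq_porbit_mem; have := mem_porbit s 1 d; rewrite expg1.
Qed.

Lemma orbit_index_surj s (i : 'I_#|porbits s|) : exists d, i = orbit_index s d.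
Proof.
have /imsetP[x _ ix] := enum_valP i.
by exists x; apply: enum_val_inj; rewrite orbit_indexK.
Qed.

Lemma mul_incidence s (u : 'rV['F_2]_#|porbits s|) j :
  ((u *m incidence s) 0 j = u 0 (orbit_index s (enum_val j)) +
                            u 0 (orbit_index s (fl (enum_val j))))%R.
Proof.
have sumE d : (\sum_i u 0 i * (d \in enum_val i)%:R = u 0 (orbit_index s d))%R.
  rewrite (bigD1 (orbit_index s d)) //= mem_orbit_index eqxx mulr1 big1 ?addr0 //.
  by move=> i /negPf; rewrite mem_orbit_index => ->; rewrite mulr0.
rewrite mxE -!sumE -big_split; apply: eq_bigr => i _.
by rewrite mxE mulrDr.
Qed.

(** A vector in the left kernel takes equal values at both ends of each edge. Connectivity, phrased
    as an induction principle on darts, makes it constant, so the kernel has dimension at most 1. *)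
Lemma rank_incidence (s : {perm D}) :
  (forall (P : D -> Prop), (forall d, P d -> P (fl d)) ->
     (forall d, P d -> P (s d)) -> forall d d', P d -> P d') ->
  #|porbits s| <= (\rank (incidence s)).+1.
Proof.
move=> conn.
have kerP : (kermx (incidence s) <= (const_mx 1%R : 'rV['F_2]_#|porbits s|))%MS.
  apply/row_subP => i; set u := row i _.
  have: (u *m incidence s = 0)%R by apply/sub_kermxP; rewrite row_sub.
  move=> /matrixP u0.
  pose h d : 'F_2 := u 0%R (orbit_index s d).
  have hfl d : h (fl d) = h d.
    wlog dE : d / d \in edge_reps.
      move=> hw; have [/hw //|] := boolP (d \in edge_reps).
      by rewrite -edge_reps_flip => /hw; rewrite flK.
    have := u0 0%R (enum_rank_in dE d).
    by rewrite mul_incidence enum_rankK_in // [RHS]mxE => e; rewrite /h (F2_add_eq0 e).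
  have [|k0] := posnP #|porbits s|.
    move=> k0; suff ->: u = 0%R by exact: sub0mx.
    by apply/rowP=> j; have := ltn_ord j; rewrite {2}k0.
  have [d0 _] := orbit_index_surj (Ordinal k0).
  suff ->: u = (h d0 *: const_mx 1%R)%R by exact: scalemx_sub.
  apply/rowP=> j; rewrite [RHS]mxE [const_mx _ _ _]mxE mulr1.
  have [d ->] := orbit_index_surj j.
  have hd : h d = h d0.
    apply: (conn (fun d => h d = h d0) _ _ d0) => // x; first by rewrite hfl.
    by rewrite /h orbit_index_next.
  exact: hd.
have := mxrankS kerP; rewrite mxrank_ker leq_subLR => /leq_trans; apply.
by have := rank_leq_row (const_mx 1%R : 'rV['F_2]_#|porbits s|); lia.
Qed.

Variables (r f : {perm D}).
Hypothesis fE : forall d, f (fl d) = r d.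
Hypothesis conn : forall (P : D -> Prop), (forall d, P d -> P (fl d)) ->
  (forall d, P d -> P (r d)) -> forall d d', P d -> P d'.
Hypothesis euler : #|porbits r| + #|porbits f| = #|D|./2 + 2.

(** Each corner of a face at a vertex involves two edge ends. Formally, [r d] and [fl d] lie in one
    [f]-orbit, so reindexing half of the sum by [r] cancels it against the other half. *)
Lemma incidence_orthogonal : (incidence r *m (incidence f)^T = 0)%R.
Proof.
apply/matrixP=> i j; rewrite !mxE.
pose g d : 'F_2 := ((d \in enum_val i)%:R *
   ((d \in enum_val j)%:R + (fl d \in enum_val j)%:R))%R.
rewrite (eq_bigr (fun k => g (enum_val k) + g (fl (enum_val k))))%R; last first.
  by move=> k _; rewrite !mxE /g flK mulrDl [((fl (enum_val k) \in enum_val j)%:R + _)%R]addrC.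
rewrite sum_edge_reps /g.
under eq_bigr do rewrite mulrDr.
rewrite big_split /= [X in (X + _)%R](reindex_inj (perm_inj (s := r))) -big_split /=.
rewrite big1 // => d _.
rewrite !mem_orbit_index orbit_index_next -(fE d) orbit_index_next.
exact: (addrr_pchar2 (pchar_Fp _)).
Qed.

(** The hypotheses are symmetric under duality. With [r] the rotation this yields 2-colorings of
    vertices; with [r] the face permutation it yields sets of faces with prescribed boundary. *)
Lemma exact_orbits (X : {set D}) :
  (forall d, (fl d \in X) = (d \in X)) ->
  (forall d, ~~ odd #|porbit f d :&: X|) ->
  exists S : {set D}, (forall d, (r d \in S) = (d \in S)) /\
    forall d, (d \in X) = (d \in S) (+) (fl d \in S).
Proof.
move=> Xfl Xf.
pose x : 'rV['F_2]_#|edge_reps| := (\row_j (enum_val j \in X)%:R)%R.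
have conn' : forall (P : D -> Prop), (forall d, P d -> P (fl d)) ->
    (forall d, P d -> P (f d)) -> forall d d', P d -> P d'.
  by move=> P Pfl Pf; apply: conn => // d /Pfl /Pf; rewrite fE.
(* Each rank is at least the number of orbits minus 1, and by Euler's formula the two numbers of
   orbits sum to the number of edges plus 2. *)
have rk : #|edge_reps| <= \rank (incidence r) + \rank (incidence f).
  have := rank_incidence conn; have := rank_incidence conn'.
  by move: euler; rewrite card_edge_reps doubleK; lia.
have x0 : (x *m (incidence f)^T = 0)%R.
  apply/matrixP=> z i; rewrite !mxE.
  have [d iE] := orbit_index_surj i.
  pose g y : 'F_2 := ((y \in X)%:R * (y \in porbit f d)%:R)%R.
  rewrite (eq_bigr (fun k => g (enum_val k) + g (fl (enum_val k))))%R; last first.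
    by move=> k _; rewrite !mxE /g Xfl mulrDr iE orbit_indexK.
  rewrite sum_edge_reps /g.
  rewrite (eq_bigr (fun y => (y \in porbit f d :&: X)%:R))%R; last first.
    by move=> y _; rewrite inE -natrM mulnb andbC.
  rewrite -natr_sum -big_mkcond sum1_card natr_F2_odd.
  by rewrite (negPf (Xf d)).
have /submxP[u xu] := exact_of_rank incidence_orthogonal rk x0.
pose h d : 'F_2 := u 0%R (orbit_index r d).
exists [set d | h d == 1]%R; split=> d; rewrite !inE.
  by rewrite /h orbit_index_next.
suff hE : (((d \in X)%:R : 'F_2) = h d + h (fl d))%R.
  move: hE; rewrite (F2_bool (h d)) (F2_bool (h (fl d))).
  by do 2 case: (_ == 1)%R; case: (_ \in X) => // /(congr1 val).
wlog dE : d / d \in edge_reps.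
  move=> hw; have [/hw //|] := boolP (d \in edge_reps).
  by rewrite -edge_reps_flip => /hw; rewrite flK Xfl addrC.
have := congr1 (fun M : 'rV_ _ => M 0%R (enum_rank_in dE d)) xu.
by rewrite mul_incidence mxE enum_rankK_in.
Qed.

End Orbits.

(** * Cycles and regions *)

Section Cycles.

Variable G : mgraph.
Implicit Types (W : seq (dart G)) (d : dart G).

Definition edge_in (A : pred (dart G)) d := A d || A (flip G d).

Lemma dst_flip d : dst (flip G d) = src d.
Proof. by rewrite /dst flipK. Qed.

Lemma cycle_uniq W : is_cycle W -> uniq W.
Proof. by case=> _ _ /map_uniq. Qed.

Lemma cycle_dart W : is_cycle W -> exists d, d \in W.
Proof. by case: W => [|d W] [] // *; exists d; rewrite mem_head. Qed.

Lemma src_next W d : is_cycle W -> d \in W -> src (next W d) = dst d.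
Proof. by case=> _ cW _ _ dW; apply/esym/eqP; apply: (next_cycle cW dW). Qed.

Lemma uniq_src_inj W : uniq (map (@src G) W) -> {in W &, injective (@src G)}.
Proof.
move=> uW x y xW yW xy; rewrite -(nth_index x xW) -(nth_index x yW).
suff -> : index x W = index y W by [].
apply/eqP; rewrite -(nth_uniq (src x) _ _ uW) ?size_map ?index_mem //.
by rewrite !(nth_map x) ?index_mem // !nth_index // xy.
Qed.

Lemma cycle_src_inj W : is_cycle W -> {in W &, injective (@src G)}.
Proof. by case=> _ _ uW _; exact: uniq_src_inj. Qed.

Lemma cycle_next_unique W x y : is_cycle W -> x \in W -> y \in W ->
  src y = dst x -> y = next W x.
Proof.
move=> cW xW yW yx; apply: (cycle_src_inj cW) => //; first by rewrite mem_next.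
by rewrite src_next.
Qed.

Lemma next_neq_flip W d : is_cycle W -> d \in W -> next W d <> flip G d.
Proof.
move=> cW dW nd; have [_ _ _ /(_ d dW)] := cW.
by rewrite -nd mem_next dW.
Qed.

Lemma cycle_darts_at W d y : is_cycle W -> d \in W -> edge_in [in W] y ->
  src y = dst d -> y = next W d \/ y = flip G d.
Proof.
move=> cW dW /orP[yW|yW] yd; first by left; exact: cycle_next_unique.
right; rewrite -[y]flipK; congr (flip G _).
apply: (can_inj (prev_next (cycle_uniq cW))).
by apply: (cycle_src_inj cW); rewrite ?mem_next // !src_next // dst_flip.
Qed.

Lemma cycle_vertex W y : is_cycle W -> edge_in [in W] y ->
  exists2 d, d \in W & src y = dst d.
Proof.
move=> cW /orP[yW|yW]; last by exists (flip G y); rewrite ?dst_flip.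
exists (prev W y); first by rewrite mem_prev.
by rewrite -(src_next cW) ?mem_prev // next_prev // (cycle_uniq cW).
Qed.

(* The oriented 1-chain carried by [A]: on each dart, the value of the
   antisymmetrized indicator. For [A] a set of faces it is the boundary of [A]. *)
Definition chain (A : pred (dart G)) d : int := ((A d)%:Z - (A (flip G d))%:Z)%R.

Lemma chain_flip A d : chain A (flip G d) = (- chain A d)%R.
Proof. by rewrite /chain flipK opprB. Qed.

Lemma cycle_chain W d : is_cycle W -> d \in W -> chain [in W] d = 1%R.
Proof. by move=> [_ _ _ fW] dW; rewrite /chain /= dW (negPf (fW _ dW)). Qed.

Lemma next_const W (x : dart G -> int) : is_cycle W ->
  {in W, forall d, x (next W d) = x d} -> {in W &, forall d d', x d = x d'}.
Proof.
move=> cW xW; suff [c xc] : exists c, {in W, forall d, x d = c}.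
  by move=> d d' /xc -> /xc ->.
case: W cW xW => [|d0 W] cW xW; first by exists 0%R.
exists (x d0).
have: path.cycle (fun d d' => x d == x d') (d0 :: W).
  by apply: cycle_from_next (cycle_uniq cW) _ => d /xW ->.
have tr : transitive (fun d d' => x d == x d') by move=> a b c /eqP ->.
move=> /= /(order_path_min tr) /allP h d; rewrite inE => /predU1P[-> //|dW]; apply/esym/eqP.
by apply: h; rewrite mem_rcons inE dW orbT.
Qed.

End Cycles.

(** * Connectivity, sets of faces and the Jordan property *)

Section PlaneGraph.

Variable G : connected_plane_graph.
Implicit Types (W : seq (dart G)) (d : dart G) (S : {set dart G}).

Notation fl := (flip G).
Notation rt := (rotation G).
Notation fp := (face_perm (rotation G)).

Lemma face_permE d : fp d = rt (fl d).
Proof. by rewrite permM. Qed.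

Lemma face_perm_flip d : fp (fl d) = rt d.
Proof. by rewrite face_permE flipK. Qed.

Lemma src_rot d : src (rt d) = src d.
Proof.
have := mem_porbit rt 1 d; rewrite expg1 rotationP inE => /eqP. exact.
Qed.

Lemma src_face_perm d : src (fp d) = dst d.
Proof. by rewrite face_permE src_rot. Qed.

Lemma outer_dart : exists d, outer_face G = porbit fp d.
Proof. by have /imsetP[d _ ->] := outer_faceP G; exists d. Qed.

Lemma vertex_dart (v : vertex G) : exists d, src d = v.
Proof.
have [d0 _] := outer_dart.
have /connectP[[|u p] /=] := @pgraph_connected G v (src d0).
  by move=> _ <-; exists d0.
by case/andP=> /existsP[d /andP[/eqP <- _]] _ _; exists d.
Qed.

Lemma dart_ind (P : dart G -> Prop) :
  (forall d, P d -> P (fl d)) -> (forall d, P d -> P (rt d)) ->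
  forall d d', P d -> P d'.
Proof.
move=> Pfl Prt.
have Psrc d d' : src d' = src d -> P d -> P d'.
  move=> e Pd; have: d' \in porbit rt d by rewrite rotationP inE e.
  by move=> /porbitP[i ->]; elim: i => [|i IH]; rewrite ?expg0 ?perm1 // expgSr permM; apply: Prt.
move=> d d'; have /connectP[p] := @pgraph_connected G (src d) (src d').
elim: p d => [|v p IH] d /=; first by move=> _ /Psrc; apply.
case/andP=> /existsP[x /andP[/eqP xd /eqP <-]] pp e Pd.
by apply: (IH (fl x)) => //; apply: Pfl; apply: Psrc Pd.
Qed.

(** This is connectivity of the dual graph: the rotation is the flip followed by the face
    permutation. *)
Lemma dart_ind_face (P : dart G -> Prop) :
  (forall d, P d -> P (fl d)) -> (forall d, P d -> P (fp d)) ->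
  forall d d', P d -> P d'.
Proof.
by move=> Pfl Pfp; apply: dart_ind => // d /Pfl /Pfp; rewrite face_perm_flip.
Qed.

Lemma card_vertex_orbits : #|porbits rt| = #|vertex G|.
Proof.
have -> : porbits rt = (fun v => [set d | src d == v]) @: [set: vertex G].
  apply/setP=> A; apply/imsetP/imsetP => [[d _ ->]|[v _ ->]].
    by exists (src d); rewrite ?rotationP.
  by have [d <-] := vertex_dart v; exists d; rewrite ?rotationP.
rewrite card_imset ?cardsT // => u v /setP uv; have [d dE] := vertex_dart u.
by have := uv d; rewrite !inE dE eqxx => /esym/eqP.
Qed.

(** A set of faces is encoded as the set of darts on their boundary walks. *)
Definition face_closed S := forall d, (fp d \in S) = (d \in S).

Definition inner S := face_closed S /\ forall d, d \in outer_face G -> d \notin S.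

Lemma face_closed_porbit S d x : face_closed S -> x \in porbit fp d ->
  (x \in S) = (d \in S).
Proof.
move=> fS /porbitP[i ->]; elim: i => [|i IH]; first by rewrite expg0 perm1.
by rewrite expgSr permM fS.
Qed.

Lemma porbit_face_closed d : face_closed (porbit fp d).
Proof.
by move=> x; rewrite -!eq_porbit_mem; congr (_ == _); apply/eqP;
  rewrite eq_porbit_mem; have := mem_porbit fp 1 x; rewrite expg1.
Qed.

Lemma outer_face_closed : face_closed (outer_face G).
Proof. by have [d ->] := outer_dart; exact: porbit_face_closed. Qed.

Lemma inner_porbit S d : inner S -> d \in S -> inner (porbit fp d).
Proof.
move=> [fS oS] dS; split=> [|x xo]; first exact: porbit_face_closed.
by apply: contra (oS x xo) => /face_closed_porbit ->.
Qed.

Lemma porbit_neq_outer d : d \notin outer_face G -> porbit fp d <> outer_face G.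
Proof. by move=> /negP dO e; apply: dO; rewrite -e porbit_id. Qed.

Lemma sum_face_permutation (h : dart G -> int) S : face_closed S ->
  (\sum_(d in S) h (fp d) = \sum_(d in S) h d)%R.
Proof.
move=> fS; rewrite [RHS](reindex_inj (perm_inj (s := fp))).
by apply: eq_bigl => d; rewrite fS.
Qed.

(** A boundary has no boundary: [fl d] and [rt d] lie on the same face, so rotating around [v]
    matches the positive terms with the negative ones. *)
Lemma divergence_free S (v : vertex G) : face_closed S ->
  (\sum_(d | src d == v) chain [in S] d = 0)%R.
Proof.
move=> fS; rewrite sumrB (reindex_inj (perm_inj (s := rt))) /=.
apply/eqP; rewrite subr_eq0; apply/eqP.
apply: eq_big => d; first by rewrite src_rot.
by rewrite -face_perm_flip fS.
Qed.

Lemma invariant_const (u : dart G -> int) :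
  (forall d, u (fl d) = u d) -> (forall d, u (fp d) = u d) ->
  forall d d', u d = u d'.
Proof.
move=> ufl ufp d d'; apply: (@dart_ind_face (fun x => u d = u x) _ _ d) => // x ->.
  by rewrite ufl.
by rewrite ufp.
Qed.

(** At each vertex of [W] only two darts of the cycle can carry the boundary of [S], so conservation
    there gives consecutive darts of [W] the same value. *)
Lemma chain_cycle_multiple W S : is_cycle W -> face_closed S ->
  (forall d, ~~ edge_in [in W] d -> (d \in S) = (fl d \in S)) ->
  exists c : int, forall d, chain [in S] d = (c * chain [in W] d)%R.
Proof.
move=> cW fS SW.
have S0 d : ~~ edge_in [in W] d -> chain [in S] d = 0%R.
  by move=> /SW e; rewrite /chain /= e subrr.
have cst : {in W, forall d, chain [in S] (next W d) = chain [in S] d}.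
  move=> d dW; have nd := next_neq_flip cW dW.
  have := divergence_free (dst d) fS.
  rewrite (bigD1 (next W d)) ?src_next //= (bigD1 (fl d)) /=; last first.
    by rewrite eqxx; apply/eqP => /esym.
  rewrite big1 ?addr0 => [|y /andP[/andP[/eqP yd /eqP yn] /eqP yf]].
    by rewrite chain_flip => /eqP; rewrite subr_eq0 => /eqP.
  by apply: S0; apply/negP=> /(cycle_darts_at cW dW) /(_ yd)[].
have [x0 x0W] := cycle_dart cW.
exists (chain [in S] x0) => d.
have [/orP[dW|dW]|dW] := boolP (edge_in [in W] d).
- by rewrite (cycle_chain cW dW) mulr1; apply: (next_const cW cst).
- rewrite -[d]flipK [LHS]chain_flip [chain [in W] _]chain_flip (cycle_chain cW dW) mulrN1.
  by congr (- _)%R; apply: (next_const cW cst).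
rewrite (S0 d dW) /chain /=.
by move: dW; rewrite negb_or => /andP[/negPf -> /negPf ->]; rewrite subrr mulr0.
Qed.

(** The edges of [W] have degree 0 or 2 at each vertex, so exactness in the dual makes them the
    boundary of a set of faces modulo 2. By [chain_cycle_multiple] this lifts to the integers, with
    a coefficient that is odd and at most 1 in absolute value. *)
Lemma jordan W : is_cycle W -> exists S (e : int),
  [/\ inner S, e = 1%R \/ e = (-1)%R &
      forall d, chain [in S] d = (e * chain [in W] d)%R].
Proof.
move=> cW; pose X := [set d | edge_in [in W] d].
have Xfl d : (fl d \in X) = (d \in X) by rewrite !inE /edge_in flipK orbC.
have Xev d : ~~ odd #|porbit rt d :&: X|.
  have [->|[y]] := set_0Vmem (porbit rt d :&: X); first by rewrite cards0.
  rewrite inE rotationP !inE => /andP[/eqP yd yW].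
  have [x xW yx] := cycle_vertex cW yW.
  suff -> : [set d' | src d' == src d] :&: X = [set next W x; fl x].
    by rewrite cards2; case: eqP => // /(next_neq_flip cW xW).
  apply/setP=> z; rewrite !inE; apply/andP/orP => [[/eqP zd zW]|].
    by case: (cycle_darts_at cW xW zW) => [|->|->]; rewrite ?eqxx ?zd -?yd //; [left|right].
  by rewrite /edge_in; case=> /eqP ->; rewrite ?mem_next ?flipK xW ?orbT ?src_next // -yd yx eqxx.
have eul : #|porbits fp| + #|porbits rt| = #|dart G|./2 + 2.
  by rewrite card_vertex_orbits addnC pgraph_euler.
have [S [fS XS]] := exact_orbits (@flipK G) (@flip_neq G)
  (fun d => esym (face_permE d)) dart_ind_face eul Xfl Xev.
have {S fS XS} [S [iS XS]] : exists S, inner S /\ forall d, (d \in X) = (d \in S) (+) (fl d \in S).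
  have [o oE] := outer_dart.
  (* Complementing keeps the boundary modulo 2 and moves the outer face out of the set. *)
  exists (if o \in S then ~: S else S); split; last first.
    by move=> d; rewrite XS; case: ifP => _ //; rewrite !inE; do 2 case: (_ \in S).
  split=> d; first by case: ifP => _; rewrite ?inE fS.
  by rewrite oE => /(face_closed_porbit fS); case: ifP => _; rewrite ?inE => ->.
have [c cE] : exists c : int, forall d, chain [in S] d = (c * chain [in W] d)%R.
  apply: chain_cycle_multiple => //; first by case: iS.
  by move=> d; have := XS d; rewrite inE => ->; do 2 case: (_ \in S).
exists S, c; split=> //.
have [x0 x0W] := cycle_dart cW.
have := cE x0; rewrite (cycle_chain cW x0W) mulr1 /chain.
have := XS x0; rewrite inE /edge_in /= x0W /=.
by case: (x0 \in S); case: (fl x0 \in S) => //= _ <-; [left|right].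
Qed.

End PlaneGraph.

(** * Digons and 4-cycles in quadrangulations *)

Section Chains.

Variable G : mgraph.
Implicit Types (W : seq (dart G)) (d x y : dart G).

Definition dart_chain x d : int := ((d == x)%:Z - (d == flip G x)%:Z)%R.

Lemma flip_eq x y : (flip G x == y) = (x == flip G y).
Proof. exact: (inv_eq (@flipK G)). Qed.

Lemma src_flip d : src (flip G d) = dst d.
Proof. by []. Qed.

Lemma dart_chain_flip x d : dart_chain (flip G x) d = (- dart_chain x d)%R.
Proof. by rewrite /dart_chain flipK opprB. Qed.

Lemma eq_chain (A B : pred (dart G)) d : A =1 B -> chain A d = chain B d.
Proof. by move=> AB; rewrite /chain !AB. Qed.

Lemma chain_seq W d : uniq W -> chain [in W] d = (\sum_(x <- W) dart_chain x d)%R.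
Proof.
elim: W => [|x W IH]; first by rewrite big_nil.
move=> /andP[xW /IH IHW]; rewrite big_cons -IHW /chain /dart_chain /= !inE -flip_eq.
have [->|_] := eqVneq d x; first by rewrite (negPf xW) (negPf (flip_neq _)) /=; case: (_ \in W).
by have [->|_] := eqVneq (flip G d) x; rewrite ?(negPf xW) /=;
  case: (d \in W); try case: (flip G d \in W).
Qed.

Lemma next_next_size W d : uniq W -> d \in W -> next W (next W d) = d -> size W <= 2.
Proof.
move=> uW dW; have [i W' rW] := rot_to dW.
rewrite -!(next_rot i uW) -(size_rot i) rW; move: uW; rewrite -(rot_uniq i) rW.
case: W' {rW} => [|y [|z W']] //=; rewrite !inE !negb_or eqxx.
case/and3P=> /and3P[/negPf dy /negPf dz _] _ _.
by rewrite eq_sym dy eqxx => e; rewrite e eqxx in dz.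
Qed.

(** After [d] a walk with distinct vertices can only continue with [flip G d], which returns to the
    start. Hence a longer closed walk with distinct vertices is a cycle. *)
Lemma closed_walk_flip W d : path.cycle (fun d d' => dst d == src d') W ->
  uniq (map (@src G) W) -> d \in W -> flip G d \in W -> size W <= 2.
Proof.
move=> cW uW dW fW; have uW' := map_uniq uW.
have nx x : x \in W -> src (next W x) = dst x by move=> xW; apply/esym/eqP/(next_cycle cW xW).
have e : next W d = flip G d by apply: (uniq_src_inj uW); rewrite ?mem_next ?nx.
apply: (next_next_size uW' dW); rewrite e.
by apply: (uniq_src_inj uW); rewrite ?mem_next ?nx ?dst_flip.
Qed.

Lemma edge_in_flip (A : pred (dart G)) d : edge_in A (flip G d) = edge_in A d.
Proof. by rewrite /edge_in flipK orbC. Qed.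

Lemma cycle_simple W x y : is_cycle W -> 2 < size W -> src x = src y -> dst x = dst y ->
  edge_in [in W] x -> edge_in [in W] y -> x = y.
Proof.
move=> cW sW; wlog xW : x y / x \in W.
  move=> hw sxy dxy xW yW; have [xW'|xW'] := orP xW; first exact: hw.
  by apply: (inv_inj (@flipK G)); apply: hw; rewrite ?dst_flip ?edge_in_flip.
move=> sxy dxy _ yW.
have fyW : edge_in [in W] (flip G y) by rewrite edge_in_flip.
have [e|/(inv_inj (@flipK G)) -> //] := cycle_darts_at cW xW fyW (esym dxy).
suff : size W <= 2 by rewrite leqNgt sW.
apply: (next_next_size (cycle_uniq cW) xW); apply/esym.
by apply: cycle_next_unique; rewrite ?mem_next // -e dst_flip.
Qed.

End Chains.

Section Regions.

Variable G : connected_plane_graph.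
Implicit Types (d x y : dart G) (S T : {set dart G}).

Notation fl := (flip G).
Notation fp := (face_perm (rotation G)).

(** This is the uniqueness principle for regions: a function on faces with no jump across any edge
    is constant, and the outer face fixes the constant. *)
Lemma invariant_zero (u : dart G -> int) :
  (forall d, u (fl d) = u d) -> (forall d, u (fp d) = u d) ->
  (forall d, d \in outer_face G -> u d = 0%R) -> forall d, u d = 0%R.
Proof.
move=> ufl ufp u0 d; have [o oE] := outer_dart G.
by rewrite (invariant_const ufl ufp d o) u0 // oE porbit_id.
Qed.

Lemma inner_chain0 S : inner S -> (forall d, chain [in S] d = 0%R) -> S = set0.
Proof.
move=> [fS oS] S0; apply/setP=> d; rewrite inE.
have := @invariant_zero (fun d => (d \in S)%:Z%R) _ _ _ d.
case: (d \in S) => // h; suff: (1 = 0 :> int)%R by [].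
apply: h => [x|x|x /oS /negPf -> //]; last by rewrite fS.
by have := S0 x; rewrite /chain /=; lia.
Qed.

Lemma chain_bound (A : pred (dart G)) d : (-1 <= chain A d <= 1)%R.
Proof. by rewrite /chain; case: (A d); case: (A _). Qed.

End Regions.

(** * Bipartiteness and the exclusion of parallel edges *)

Section Quadrangulation.

Variables (G : connected_plane_graph) (C : seq (dart G)).
Hypotheses (cycC : is_cycle C) (sizeC : 6 <= size C) (bndC : bounds C (outer_face G)).
Hypothesis quad : forall F, F \in faces G -> F <> outer_face G -> face_length F = 4.
Implicit Types (d x y : dart G) (S T : {set dart G}).

Notation fl := (flip G).
Notation rt := (rotation G).
Notation fp := (face_perm (rotation G)).

Lemma edge_in_outer d : edge_in [in outer_face G] d = edge_in [in C] d.
Proof. by move: bndC => /(congr1 snd) /= /setP /(_ d); rewrite !inE. Qed.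

Lemma porbit_in_faces d : porbit fp d \in faces G.
Proof. exact: imset_f. Qed.

Lemma card_inner_face d : d \notin outer_face G -> #|porbit fp d| = 4.
Proof. by move=> /porbit_neq_outer; apply: quad; apply: porbit_in_faces. Qed.

Lemma even_dart : ~~ odd #|dart G|.
Proof. by rewrite (card_edge_reps (@flipK G) (@flip_neq G)) odd_double. Qed.

(** Only the outer face needs an argument: the face lengths sum to the even number of darts, and all
    the others are 4. *)
Lemma even_face d : ~~ odd #|porbit fp d|.
Proof.
have [dO|/card_inner_face -> //] := boolP (d \in outer_face G).
have [o oE] := outer_dart G.
have -> : porbit fp d = outer_face G.
  by apply/eqP; rewrite oE eq_porbit_mem -oE.
have cardD : #|dart G| = \sum_(F in faces G) #|F|.
  rewrite -sum1_card (partition_big (porbit fp) [in faces G]) /=; last first.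
    by move=> x _; exact: porbit_in_faces.
  apply: eq_bigr => F /imsetP[x _ ->]; rewrite sum1_card; apply: eq_card => y.
  by rewrite -[RHS]eq_porbit_mem.
have := even_dart; rewrite cardD (bigD1 (outer_face G)) ?outer_faceP //= oddD negb_add.
suff -> : odd (\sum_(F in faces G | F != outer_face G) #|F|) = false by case: odd.
apply/negbTE; rewrite -dvdn2; apply: dvdn_sum => F /andP[Ff /eqP Fo].
by rewrite -[#|F|]/(face_length F) quad.
Qed.

(** All faces are even, so [exact_orbits] applies to the set of all edges. The resulting [S] is
    constant around each vertex and hence defines a class of vertices. *)
Lemma bipartite : exists kappa : vertex G -> bool,
  forall d, kappa (dst d) = ~~ kappa (src d).
Proof.
have eul : #|porbits rt| + #|porbits fp| = #|dart G|./2 + 2.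
  by rewrite card_vertex_orbits pgraph_euler.
have [S [rS flS]] := exact_orbits (@flipK G) (@flip_neq G) (@face_perm_flip G)
  (@dart_ind G) eul (X := setT) (fun d => etrans (in_setT _) (esym (in_setT _)))
  (fun d => ltac:(by rewrite setIT even_face)).
pose kappa v := [exists d, (src d == v) && (d \in S)].
have kE d : kappa (src d) = (d \in S).
  apply/existsP/idP => [[x /andP[/eqP xd xS]]|dS]; last by exists d; rewrite eqxx.
  have: d \in porbit rt x by rewrite rotationP inE xd.
  by case/porbitP=> i ->; elim: i => [|i IH]; rewrite ?expg0 ?perm1 // expgSr permM rS.
exists kappa => d; rewrite [dst d]/(src (fl d)) !kE.
by have := flS d; rewrite inE; case: (d \in S); case: (_ \in S).
Qed.

Lemma no_loop d : src d <> dst d.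
Proof. by have [k kE] := bipartite; move=> e; have := kE d; rewrite -e; case: (k _). Qed.

(** [F] is internal because [K] is shorter than [C]. The boundaries of [S] and [F] are both [K] up
    to sign, so by uniqueness the two indicators agree up to sign, hence agree. *)
Lemma bounded_region K F S (e : int) : is_cycle K -> size K = 4 ->
  F \in faces G -> bounds K F -> inner S -> e = 1%R \/ e = (-1)%R ->
  (forall d, chain [in S] d = (e * chain [in K] d)%R) -> S = F.
Proof.
move=> cK sK Ff bKF iS e1 SK.
have Fo : F <> outer_face G.
  move=> Fo; have CK : cycle_subgraph C = cycle_subgraph K by rewrite -bKF -bndC Fo.
  have /= := congr1 (fun H : subgraph G => #|H.1|) CK.
  have cs W : is_cycle W -> #|[set v | v \in map (@src G) W]| = size W.
    by case=> _ _ uW _; rewrite cardsE (card_uniqP uW) size_map.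
  by rewrite !cs // sK => h; move: sizeC; rewrite h.
have [x0 _ FE] := imsetP Ff.
have iF : inner F.
  rewrite FE; split=> [|x xO]; first exact: porbit_face_closed.
  apply/negP=> xF; apply: Fo; rewrite FE.
  have [o oE] := outer_dart G; rewrite oE; move: xO xF.
  by rewrite oE -!eq_porbit_mem => /eqP -> /eqP ->.
have eFK d : edge_in [in F] d = edge_in [in K] d.
  by move: bKF => /(congr1 snd) /= /setP /(_ d); rewrite !inE.
have [c cE] : exists c : int, forall d, chain [in F] d = (c * chain [in K] d)%R.
  apply: chain_cycle_multiple => //; first by case: iF.
  by move=> d; rewrite -eFK negb_or => /andP[/negPf /= -> /negPf /= ->].
have x0F : x0 \in F by rewrite FE porbit_id.
have c1 : c = 1%R \/ c = (-1)%R.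
  have c0 : c <> 0%R.
    move=> c0; have := inner_chain0 iF _; rewrite c0 in cE => F0.
    by move: x0F; rewrite F0 ?inE // => d; rewrite cE mul0r.
  case: K cK {sK SK bKF eFK} cE => [[]//|k K] cK cE.
  have := cE k; rewrite (cycle_chain cK) ?mem_head // mulr1.
  by have := chain_bound [in F] k; lia.
(* The ratio of the two boundaries is [e / c], which is [e * c] because [c] is 1 or -1. *)
have u0 d : ((d \in S)%:Z - e * c * (d \in F)%:Z = 0)%R.
  apply: (invariant_zero (u := fun d => ((d \in S)%:Z - e * c * (d \in F)%:Z)%R)) => {d} [d|d|d dO].
  - have := SK d; have := cE d; rewrite /chain /=.
    by case: e1 => ->; case: c1 => ->; lia.
  - by case: iS iF => -> _ [-> _].
  by case: iS iF => _ /(_ d dO) /negPf -> [_ /(_ d dO) /negPf ->]; rewrite mulr0.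
apply/setP=> d; have := u0 d; have := u0 x0; rewrite x0F.
by case: e1 => ->; case: c1 => ->; case: (x0 \in S); case: (d \in S); case: (d \in F).
Qed.

Definition parallel x y := src x = src y /\ dst x = dst y.

(** The sign of the boundary is fixed: it runs along [x] and back along [fl y], with [S] on the side
    of [x]. *)
Definition digon_region x y S :=
  [/\ x <> y, parallel x y, inner S &
      forall d, chain [in S] d = (dart_chain x d - dart_chain y d)%R].

Lemma parallel_flip x y : parallel x y -> parallel (fl x) (fl y).
Proof. by case=> sxy dxy; split; rewrite ?dst_flip. Qed.

(** For distinct darts, [x] followed by [fl y] is a 2-cycle. Equal darts are allowed and get the
    empty region, which lets [split_region] treat degenerate digons uniformly. *)
Lemma parallel_jordan x y : parallel x y -> exists S (e : int),
  [/\ inner S, e = 1%R \/ e = (-1)%R &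
      forall d, chain [in S] d = (e * (dart_chain x d - dart_chain y d))%R].
Proof.
move=> [sxy dxy]; have [->|nxy] := eqVneq x y.
  exists set0, 1%R; split; [|by left|by move=> d; rewrite subrr mulr0 /chain /= !inE].
  by split=> d; rewrite !inE.
have nl := @no_loop x.
have cW : is_cycle [:: x; fl y].
  split=> //=; first by rewrite dst_flip -sxy /dst !eqxx /= -/(dst y) -dxy eqxx.
    by rewrite inE andbT; apply/eqP; rewrite -[src (fl y)]/(dst y) -dxy.
  move=> d; rewrite !inE => /orP[] /eqP ->; rewrite negb_or.
    by rewrite flip_neq (inj_eq perm_inj).
  by rewrite flip_neq flipK eq_sym nxy.
have [S [e [iS e1 SE]]] := jordan cW; exists S, e; split=> // d.
by rewrite SE chain_seq ?(cycle_uniq cW) // !big_cons big_nil addr0 dart_chain_flip.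
Qed.

Lemma digon_region_of x y S T : parallel x y -> inner S -> T \subset S -> T != set0 ->
  (forall d, chain [in S] d = (1 * (dart_chain x d - dart_chain y d))%R) ->
  digon_region x y S.
Proof.
move=> pxy iS TS /set0Pn[z zT] SE; split=> // [xy|d]; last by rewrite SE mul1r.
have := subsetP TS z zT.
by rewrite (inner_chain0 iS) ?inE // => d; rewrite SE xy subrr mulr0.
Qed.

(* A 4-walk bounding T that is not a cycle splits into two digons, whose regions
   A and B satisfy T = +-A +- B as chains. A minus sign puts T inside one digon;
   two plus signs would make A and B disjoint, and the edges of the face of x1
   then force one of the digons to be degenerate. *)
Lemma split_region T a x1 x2 x3 n : inner T -> x1 \in T -> x2 \in porbit fp x1 ->
  parallel a (fl x1) -> parallel x2 (fl x3) ->
  (forall d, chain [in T] d = (dart_chain a d - dart_chain (fl x1) d +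
                               (dart_chain x2 d - dart_chain (fl x3) d))%R) ->
  n < #|T| -> exists x y S, digon_region x y S /\ n < #|S|.
Proof.
move=> iT x1T x12 pa px TE nT.
have [A [e [iA e1 AE]]] := parallel_jordan pa.
have [B [e' [iB e1' BE]]] := parallel_jordan px.
have u0 d : ((d \in T)%:Z = e * (d \in A)%:Z + e' * (d \in B)%:Z)%R.
  apply/eqP; rewrite -subr_eq0; apply/eqP.
  pose u x := ((x \in T)%:Z - (e * (x \in A)%:Z + e' * (x \in B)%:Z))%R.
  apply: (invariant_zero (u := u)) => {d} [d|d|d dO]; rewrite /u.
  - have := TE d; have := AE d; have := BE d; rewrite /chain /=.
    by case: e1 => ->; case: e1' => ->; lia.
  - by case: iT iA iB => -> _ [-> _] [-> _].
  by case: iT iA iB => _ /(_ d dO) /negPf ->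
    [_ /(_ d dO) /negPf ->] [_ /(_ d dO) /negPf ->]; rewrite !mulr0.
have T0 : T != set0 by rewrite -card_gt0; lia.
have useA : T \subset A -> e = 1%R -> exists x y S, digon_region x y S /\ n < #|S|.
  move=> TA ee; exists a, (fl x1), A; split; last by have := subset_leq_card TA; lia.
  by apply: digon_region_of TA T0 _ => //; rewrite -ee.
have useB : T \subset B -> e' = 1%R -> exists x y S, digon_region x y S /\ n < #|S|.
  move=> TB ee; exists x2, (fl x3), B; split; last by have := subset_leq_card TB; lia.
  by apply: digon_region_of TB T0 _ => //; rewrite -ee.
(* With a minus sign on [A], a dart of [T] can only be accounted for by [B], taken with a plus
   sign. *)
case: e1 => ee; last first.
  have TB : T \subset B.
    apply/subsetP=> d dT; have := u0 d; rewrite dT ee.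
    by case: e1' => ->; case: (d \in A); case: (d \in B).
  apply: (useB TB); have := u0 x1; rewrite x1T (subsetP TB) // ee.
  by case: e1' => ->; case: (_ \in A).
case: e1' => ee'; last first.
  apply: (useA _ ee); apply/subsetP=> d dT; have := u0 d; rewrite dT ee ee'.
  by case: (d \in A); case: (d \in B).
have x12A : (x2 \in A) = (x1 \in A) by apply: face_closed_porbit x12; case: iA.
have x12B : (x2 \in B) = (x1 \in B) by apply: face_closed_porbit x12; case: iB.
have := u0 x1; rewrite x1T ee ee' !mul1r.
case: (boolP (x1 \in A)) x12A => [x1A x2A|x1A x2A] /=; last first.
  case: (boolP (x1 \in B)) x12B => // x1B x2B _.
  apply: (useB _ ee'); apply/subsetP=> d dT.
  (* As [x1] is not in [A], the boundary of [A] is at most 0 at [x1], whereas the term of [fl x1]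
     contributes 1 there; only [a = fl x1] can cancel it. *)
  have /eqP af : a == fl x1.
    have := AE x1; rewrite ee /chain /dart_chain /= (negPf x1A) !flipK eqxx.
    rewrite [x1 == fl x1]eq_sym (negPf (flip_neq _)) -[x1 == fl a]flip_eq [fl x1 == a]eq_sym.
    by case: (a == fl x1); case: (x1 == a); case: (fl x1 \in A).
  have := u0 d; rewrite dT ee ee' (inner_chain0 iA) ?inE; first by case: (d \in B).
  by move=> z; rewrite AE af subrr mulr0.
case: (boolP (x1 \in B)) x12B => // x1B x2B _.
apply: (useA _ ee); apply/subsetP=> d dT.
have /eqP af : x2 == fl x3.
  have := BE x2; rewrite ee' /chain /dart_chain /= x2B !flipK eqxx.
  rewrite [x2 == fl x2]eq_sym (negPf (flip_neq _)).
  by case: (x2 == fl x3); case: (x2 == x3); case: (fl x2 \in B).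
have := u0 d; rewrite dT ee ee' (inner_chain0 iB) ?inE; first by case: (d \in A).
by move=> z; rewrite BE af subrr mulr0.
Qed.

Lemma inner_faceE d : d \notin outer_face G ->
  [/\ porbit fp d =i [:: d; fp d; fp (fp d); fp (fp (fp d))],
      uniq [:: d; fp d; fp (fp d); fp (fp (fp d))] &
      fp (fp (fp (fp d))) = d].
Proof.
move=> /card_inner_face d4.
have e : traject fp d #|porbit fp d| = [:: d; fp d; fp (fp d); fp (fp (fp d))] by rewrite d4.
split; first by move=> x; rewrite porbit_traject e.
  by rewrite -e; exact: uniq_traject_porbit.
by have := iter_porbit fp d; rewrite d4.
Qed.

Lemma parallel_not_outer x y : x <> y -> parallel x y ->
  ~~ edge_in [in outer_face G] x \/ ~~ edge_in [in outer_face G] y.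
Proof.
move=> nxy [sxy dxy]; apply/orP; rewrite -negb_and !edge_in_outer; apply/andP=> -[xO yO].
by apply: nxy; apply: (cycle_simple cycC _ sxy dxy); rewrite ?(leq_trans _ sizeC).
Qed.

Hypothesis nosep : ~ (exists K : seq (dart G), separating_cycle K /\ size K = 4).

Lemma four_cycle_bounds K : is_cycle K -> size K = 4 ->
  exists2 F, F \in faces G & bounds K F.
Proof.
move=> cK sK.
have [/exists_inP[F Ff /eqP bF]|nF] :=
  boolP [exists F in faces G, face_boundary F == cycle_subgraph K].
  by exists F.
case: nosep; exists K; split=> //; split=> // -[F Ff bF].
by case/negP: nF; apply/exists_inP; exists F; rewrite // -bF.
Qed.

Lemma digon_region_flip x y S : digon_region x y S -> digon_region (fl y) (fl x) S.
Proof.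
move=> [nxy pxy iS SE]; split=> // [/perm_inj/esym // ||d].
  by apply: parallel_flip; case: pxy.
by rewrite SE !dart_chain_flip opprK addrC.
Qed.

Lemma digon_region_sides x y S : digon_region x y S ->
  [/\ x \in S, fl x \notin S, y \notin S & fl y \in S].
Proof.
move=> [nxy [sxy dxy] iS SE].
have xfy : x != fl y by apply/eqP=> e; apply: (@no_loop y); rewrite -sxy e.
have yx : (y == x) = false by apply/eqP=> /esym.
have := SE x; have := SE y; rewrite /chain /dart_chain /= !eqxx [x == y]eq_sym yx.
rewrite -[y == fl x]flip_eq [fl y == x]eq_sym (negPf xfy).
rewrite [y == fl y]eq_sym [x == fl x]eq_sym !(negPf (flip_neq _)).
by case: (x \in S); case: (y \in S); case: (fl x \in S); case: (fl y \in S).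
Qed.

(** Adjoin to [S] the internal face across [y], with boundary [y p q r]. The union [T] is bounded by
    the closed walk [x p q r]. If this is a cycle, it would have to bound a single face; otherwise
    it splits into two digons, one of which gives a larger region. *)
Lemma digon_region_step x y S : digon_region x y S ->
  exists x' y' S', digon_region x' y' S' /\ #|S| < #|S'|.
Proof.
(* One of the parallel edges is off the outer cycle; reversing the digon turns it into the edge of
   [y]. *)
wlog yO : x y / y \notin outer_face G.
  move=> hw dS; have [nxy pxy _ _] := dS.
  have [|] := parallel_not_outer nxy pxy; rewrite negb_or => /andP[O1 O2]; last exact: hw dS.
  exact: hw O2 (digon_region_flip dS).
move=> dS; have [xS fxS yS fyS] := digon_region_sides dS.
case: dS => nxy [sxy dxy] [fS oS] SE.
have [Qmem Quniq Q4] := inner_faceE yO.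
have := Quniq; move: Qmem Q4.
have := src_face_perm y; set p := fp y => sp.
have := src_face_perm p; set q := fp p => sq.
have := src_face_perm q; set r := fp q => sr.
have := src_face_perm r => + Qmem Q4; rewrite Q4 => sy.
move=> {}Quniq; pose T := S :|: porbit fp y.
have QS d : d \in porbit fp y -> d \notin S by move=> /(face_closed_porbit fS) ->.
have iT : inner T.
  split=> d; first by rewrite !inE fS porbit_face_closed.
  move=> dO; rewrite inE (negPf (oS d dO)) /=; apply: contra yO => dy.
  by have := face_closed_porbit (@outer_face_closed G) dy; rewrite dO => <-.
have cT : #|S| < #|T|.
  by apply: proper_card; apply/properP; split;
    [exact: subsetUl|exists y; rewrite // inE porbit_id orbT].
have TE d : chain [in T] d =
    (dart_chain x d + (dart_chain p d + (dart_chain q d + dart_chain r d)))%R.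
  have -> : chain [in T] d = (chain [in S] d + chain [in porbit fp y] d)%R.
    rewrite /chain /= !in_setU.
    have := QS d; have := QS (fl d).
    case: (d \in S); case: (d \in porbit _ _); case: (fl d \in S);
      case: (fl d \in porbit _ _) => // h1 h2; solve [by have := h1 isT | by have := h2 isT].
  rewrite SE (eq_chain (B := [in [:: y; p; q; r]])) // chain_seq // !big_cons big_nil addr0.
  by rewrite addrA subrK.
have yT : y \in T by rewrite inE porbit_id orbT.
have mT d : d \in [:: y; p; q; r] -> d \in T by rewrite -Qmem inE => ->; rewrite orbT.
have face_eq d d' : d \in [:: y; p; q; r] -> d' \in [:: y; p; q; r] -> d' \in porbit fp d.
  by rewrite -!Qmem -!eq_porbit_mem => /eqP -> /eqP ->.
(* By bipartiteness, only opposite vertices of the walk can coincide. Either coincidence cuts it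
   into two closed walks of length 2. *)
have [e|/eqP nsq] := eqVneq (src y) (src q).
  apply: (@split_region T x p q r) => //; rewrite ?mT ?face_eq ?inE ?eqxx ?orbT //.
  - by split; rewrite ?dst_flip ?src_flip ?sxy ?dxy ?sp // e sq.
  - by split; rewrite ?dst_flip ?src_flip -?sy ?e ?sr.
  by move=> d; rewrite TE !dart_chain_flip !opprK !addrA.
have [e|/eqP nsr] := eqVneq (src p) (src r).
  apply: (@split_region T x r p q) => //; rewrite ?mT ?face_eq ?inE ?eqxx ?orbT //.
  - by split; rewrite ?dst_flip ?src_flip ?sxy ?dxy -?sy // -sp e.
  - by split; rewrite ?dst_flip ?src_flip -?sr ?e ?sq.
  by move=> d; rewrite TE !dart_chain_flip !opprK; lia.
(* The walk is now a 4-cycle, so [T] is a single face; but it contains [y], outside [S], and [fl y],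
   inside the face-closed set [S]. *)
exfalso.
pose K := [:: x; p; q; r].
have cK : path.cycle (fun d d' => dst d == src d') K.
  by rewrite /= dxy -sp -sq -sr -sy sxy !eqxx.
have uK : uniq (map (@src G) K).
  have n1 := @no_loop y; have n2 := @no_loop p; have n3 := @no_loop q; have n4 := @no_loop r.
  rewrite -sp in n1; rewrite -sq in n2; rewrite -sr in n3; rewrite -sy in n4.
  rewrite /= !inE sxy !negb_or; apply/and4P; split=> //.
  - by apply/and3P; split; apply/eqP => // /esym.
  - by apply/andP; split; apply/eqP.
  by apply/eqP.
have iK : is_cycle K.
  split=> // d dK; apply/negP=> fK.
  by have := closed_walk_flip cK uK dK fK.
have [F Ff bF] := four_cycle_bounds iK erefl.
have TF : T = F.
  apply: (bounded_region iK _ Ff bF iT (e := 1%R)) => //; first by left.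
  by move=> d; rewrite TE mul1r chain_seq ?(cycle_uniq iK) // !big_cons big_nil addr0.
have [z _ zF] := imsetP Ff; move: yT; rewrite TF zF => yz.
have : fl y \in porbit fp z by rewrite -zF -TF inE fyS.
by move: yz; rewrite -eq_porbit_mem => /eqP <- /QS; rewrite fyS.
Qed.

(** Two distinct parallel edges would start an endless growth of digon regions, beyond the number of
    darts. *)
Lemma no_parallel x y : parallel x y -> x = y.
Proof.
move=> pxy; apply/eqP/negPn/negP=> /eqP nxy.
have grow n : exists x y S, digon_region x y S /\ n <= #|S|.
  elim: n => [|n [a [b [S [dS nS]]]]]; last first.
    have [a' [b' [S' [dS' nS']]]] := digon_region_step dS.
    by exists a', b', S'; split=> //; apply: leq_ltn_trans nS'.
  have [S [e [iS e1 SE]]] := parallel_jordan pxy.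
  case: e1 SE => -> SE; [exists x, y, S|exists y, x, S]; split=> //; split=> //.
  - by move=> d; rewrite SE mul1r.
  - by move/esym.
  - by case: pxy.
  by move=> d; rewrite SE mulN1r opprB.
have [a [b [S [_]]]] := grow #|dart G|.+1.
by rewrite ltnNge max_card.
Qed.

End Quadrangulation.

(** * Recoloring inside a separating 4-cycle *)

Section Recoloring.

Variables (G : connected_plane_graph) (kappa : vertex G -> bool).
Hypothesis kappaP : forall d : dart G, kappa (dst d) = ~~ kappa (src d).
Variables (K : seq (dart G)) (S : {set dart G}) (e : int).
Hypotheses (cK : is_cycle K) (sK : size K = 4).
Hypotheses (iS : inner S) (e1 : e = 1%R \/ e = (-1)%R).
Hypothesis SK : forall d, chain [in S] d = (e * chain [in K] d)%R.
Variables (psi : vertex G -> 'I_3) (d0 : dart G).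
Hypotheses (d0S : d0 \in S) (d0K : ~~ edge_in [in K] d0).
Hypothesis psiP : forall d, d != d0 -> d != flip G d0 -> psi (src d) <> psi (dst d).
Implicit Types (d x y : dart G).

Notation fl := (flip G).
Notation rt := (rotation G).
Notation fp := (face_perm (rotation G)).

Lemma region_step d : ~~ edge_in [in K] d -> (fl d \in S) = (d \in S).
Proof.
rewrite negb_or => /andP[/negPf dK /negPf fK]; have := SK d.
by rewrite /chain /= dK fK mulr0; case: (d \in S); case: (fl d \in S).
Qed.

Lemma region_cross d : edge_in [in K] d -> (fl d \in S) = (d \notin S).
Proof.
have [_ _ _ fK] := cK; have := SK d; rewrite /chain /edge_in /= => h /orP[dK|dK].
  by move: h; rewrite dK (negPf (fK _ dK)); case: e1 => ->; case: (d \in S); case: (fl d \in S).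
move: (fK _ dK) h; rewrite flipK dK => /negPf ->.
by case: e1 => ->; case: (d \in S); case: (fl d \in S).
Qed.

Lemma edge_in_src d : edge_in [in K] d -> src d \in map (@src G) K.
Proof.
move=> /(cycle_vertex cK)[x xK ->].
by rewrite -(src_next cK xK) map_f // mem_next.
Qed.

(** Rotating around a vertex off [K] never crosses [K], so lying inside [K] is well defined for such
    a vertex. *)
Lemma region_at_vertex x y : src x = src y -> src x \notin map (@src G) K ->
  (x \in S) = (y \in S).
Proof.
move=> xy xK; have: y \in porbit rt x by rewrite rotationP inE xy.
case/porbitP=> i ->.
have srcE j : src ((rt ^+ j)%g x) = src x.
  by elim: j => [|j IH]; rewrite ?expg0 ?perm1 // expgSr permM src_rot.
elim: i => [|i IH]; first by rewrite expg0 perm1.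
rewrite expgSr permM -face_perm_flip (iS.1) region_step //.
by apply: contra xK => /edge_in_src; rewrite srcE.
Qed.

(** Three colors on a 4-cycle force two opposite vertices to agree: [a] is their color and [b] their
    side of the bipartition. Their neighbors on [K] then avoid [a]. *)
Lemma four_cycle_class : exists (b : bool) (a : 'I_3), {in K, forall x,
  if kappa (src x) == b then psi (src x) = a else psi (src x) <> a}.
Proof.
have psiK : {in K, forall x, psi (src x) <> psi (dst x)}.
  move=> x xK; have xe : edge_in [in K] x by rewrite /edge_in /= xK.
  apply: psiP; apply: contraNneq d0K => xd; first by rewrite -xd.
  by rewrite -edge_in_flip -xd.
case: K sK cK psiK => [|x0 [|x1 [|x2 [|x3 [|]]]]] // _ [_ /= c4 _ _] psi4.
case/and5P: c4 => /eqP s1 /eqP s2 /eqP s3 /eqP s4 _.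
have k0 := kappaP x0; have k1 := kappaP x1; have k2 := kappaP x2.
rewrite s1 in k0; rewrite s2 in k1; rewrite s3 in k2.
have p0 := psi4 x0; have p1 := psi4 x1; have p2 := psi4 x2; have p3 := psi4 x3.
move: p0 p1 p2 p3; rewrite !inE !eqxx !orbT s1 s2 s3 s4.
move=> /(_ isT) p0 /(_ isT) p1 /(_ isT) p2 /(_ isT) p3.
have [p02|p13] : psi (src x0) = psi (src x2) \/ psi (src x1) = psi (src x3).
  move: p0 p1 p2 p3; move: (psi _) (psi _) (psi _) (psi _) => [a a3] [b b3] [c c3] [d d3].
  have E (u v : nat) (hu : u < 3) (hv : v < 3) : (Ordinal hu = Ordinal hv) <-> u = v.
    by split=> [[]|uv] //; apply: val_inj.
  by rewrite !E; lia.
  exists (kappa (src x0)), (psi (src x0)) => x; rewrite !inE => /or4P[] /eqP ->;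
    rewrite ?k2 ?k1 ?k0 ?negbK ?eqxx //; case: (kappa _) => //=; congruence.
exists (kappa (src x1)), (psi (src x1)) => x; rewrite !inE => /or4P[] /eqP ->;
  rewrite ?k2 ?k1 ?k0 ?negbK ?eqxx //; case: (kappa _) => //=; congruence.
Qed.

(** Inside [K], side [b] receives [a] and the other side another color [c]. This fits the colors on
    [K] and is proper on every edge of the region, including that of [d0]; elsewhere [psi] is
    kept. *)
Lemma recolor : exists Psi : vertex G -> 'I_3, proper_coloring (whole G) Psi /\
  forall d, d \in outer_face G -> Psi (src d) = psi (src d).
Proof.
have [b [a Ka]] := four_cycle_class.
have [c ca] : exists c : 'I_3, c <> a.
  by case: a {Ka} => [[|m] am];
    [exists (Ordinal (isT : 1 < 3))|exists (Ordinal (isT : 0 < 3))] => -[].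
pose ins v := (v \notin map (@src G) K) && [exists x, (src x == v) && (x \in S)].
pose Psi v := if ins v then (if kappa v == b then a else c) else psi v.
have insE d : src d \notin map (@src G) K -> ins (src d) = (d \in S).
  move=> dK; rewrite /ins dK /=; apply/existsP/idP => [[x /andP[/eqP xd xS]]|dS].
    by rewrite -(region_at_vertex xd) // xd.
  by exists d; rewrite eqxx.
exists Psi; split; last first.
  move=> d dO; rewrite /Psi; case: ifP => // dI; have := dI; case/andP=> dK _.
  by move: dI; rewrite insE // (negPf (iS.2 d dO)).
(* On the closed region, color [a] marks exactly side [b]; as the ends of an edge lie on opposite
   sides, its colors differ. *)
have PsiS d : (d \in S) || (fl d \in S) ->
    if kappa (src d) == b then Psi (src d) = a else Psi (src d) <> a.
  move=> dS; rewrite /Psi; case: (boolP (ins (src d))) => [_|]; first by case: (kappa _ == b).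
  have [/mapP[x xK ->] _|dK] := boolP (src d \in map (@src G) K); first exact: Ka.
  have dK' : ~~ edge_in [in K] d by apply: contra dK; apply: edge_in_src.
  by rewrite insE //; move: dS; rewrite region_step // orbb => ->.
move=> d _; have [dS|] := boolP ((d \in S) || (fl d \in S)).
  have := PsiS d dS; have := PsiS (fl d); rewrite flipK orbC dS => /(_ isT).
  rewrite src_flip kappaP; case: (kappa _); case: (b) => /=; congruence.
rewrite negb_or => /andP[dS fS].
have ins0 x : x \notin S -> ins (src x) = false.
  move=> xS; have [xK|xK] := boolP (src x \in map (@src G) K); first by rewrite /ins xK.
  by rewrite insE // (negPf xS).
rewrite /Psi (ins0 d) // -src_flip (ins0 (fl d)) //; apply: psiP.
  by apply: contraNneq dS => ->.
by apply: contraNneq fS => ->; rewrite flipK.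
Qed.

End Recoloring.

(** Criticality is applied to the graph without an edge strictly inside [K]; recoloring contradicts
    the failure to extend to [G]. *)
Lemma critical_no_separating (G : connected_plane_graph) (C : seq (dart G)) :
  is_cycle C -> 6 <= size C -> bounds C (outer_face G) ->
  (forall F, F \in faces G -> F <> outer_face G -> face_length F = 4) ->
  critical (cycle_subgraph C) ->
  ~ (exists K : seq (dart G), separating_cycle K /\ size K = 4).
Proof.
move=> cC sC bC quad [_ crit] [K [[cK nbK] sK]].
have [kappa kappaP] := bipartite quad.
have [S [e [iS e1 SK]]] := jordan cK.
have [fS oS] := iS.
have cross := region_cross cK e1 SK; have step := region_step SK.
(* If all darts of [S] were on [K], the boundary of any one face in [S] would be a nonzero multiple
   of [K], so [K] would bound that face and not be separating. *)
have [d0 d0S d0K] : exists2 d0, d0 \in S & ~~ edge_in [in K] d0.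
  have [/exists_inP[d0 ? ?]|] := boolP [exists d0 in S, ~~ edge_in [in K] d0]; first by exists d0.
  rewrite negb_exists_in => /forall_inP SKb; case: nbK.
  have [k kK] := cycle_dart cK.
  have [z zS] : exists z, z \in S.
    have : edge_in [in K] k by rewrite /edge_in /= kK.
    by move/cross; have [|_ fkS] := boolP (k \in S); [exists k|exists (flip G k)].
  have iF := inner_porbit iS zS; have [fF oF] := iF.
  pose F := porbit (face_perm (rotation G)) z.
  have FS x : x \in F -> x \in S by move=> /(face_closed_porbit fS) ->.
  have SKe x : x \in S -> edge_in [in K] x by move=> /SKb; rewrite negbK.
  exists F; first exact: imset_f.
  have Fstep d : ~~ edge_in [in K] d -> (d \in F) = (flip G d \in F).
    move=> dK; have dS : d \notin S by apply: contra dK; apply: SKe.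
    by apply/idP/idP => /FS; rewrite ?step // (negPf dS).
  have [c cE] := chain_cycle_multiple cK fF Fstep.
  have c1 : c <> 0%R.
    move=> c0; have := cE z; rewrite c0 mul0r /chain /= porbit_id.
    have := cross z (SKe z zS); rewrite zS /= => fzS.
    by have [/FS|//] := boolP (flip G z \in F); rewrite fzS.
  have EF d : edge_in [in F] d = edge_in [in K] d.
    apply/idP/idP => [/orP[/FS/SKe //|/FS/SKe]|dK]; first by rewrite edge_in_flip.
    apply: contraT; rewrite negb_or => /andP[/= /negPf dF /negPf fdF].
    have := cE d; rewrite /chain /= dF fdF; have [_ _ _ fK] := cK.
    case/orP: dK => /= dK; first by rewrite dK (negPf (fK _ dK)); lia.
    by move: (fK _ dK); rewrite flipK dK => /negPf ->; lia.
  congr (_, _); last by apply/setP=> d; have := EF d; rewrite !inE.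
  apply/setP=> v; rewrite inE; apply/imsetP/mapP => [[d dF ->]|[d dK ->]].
    have dK : edge_in [in K] d by rewrite -EF /edge_in /= dF.
    by have /mapP[x xK ->] := edge_in_src cK dK; exists x.
  have : edge_in [in F] d by rewrite EF /edge_in /= dK.
  case/orP=> dF; first by exists d.
  by exists (face_perm (rotation G) (flip G d)); rewrite ?fF // src_face_perm dst_flip.
have d0C : ~~ edge_in [in C] d0.
  rewrite -(edge_in_outer bC); apply/negP=> /orP[] /oS; first by rewrite d0S.
  by rewrite step // d0S.
pose H : subgraph G := ([set: vertex G], [set d | (d != d0) && (d != flip G d0)]).
have [||phi [_ [psi [psiH psiC]] noext]] := crit H.
- split; first by move=> d; rewrite !inE !flip_eq flipK andbC.
  by move=> /(congr1 snd) /= /setP /(_ d0); rewrite !inE eqxx.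
- split; first exact: subsetT.
  apply/subsetP=> d; rewrite !inE -/(edge_in [in C] d) => dC.
  apply/andP; split; apply: contraNneq d0C => dd; first by rewrite -dd.
  by rewrite -edge_in_flip -dd.
have psiP d : d != d0 -> d != flip G d0 -> psi (src d) <> psi (dst d).
  by move=> n1 n2; apply: psiH; rewrite inE n1.
have [Psi [PsiP PsiO]] := recolor kappaP cK sK iS e1 SK d0S d0K psiP.
apply: noext; exists Psi; split=> // v vC; rewrite -psiC //.
move: vC; rewrite inE => /mapP[d dC ->].
have : edge_in [in outer_face G] d by rewrite (edge_in_outer bC) /edge_in /= dC.
case/orP=> dO; first exact: PsiO.
(* If only the reverse of [d] is on the outer walk, the source of [d] is the source of the next dart
   of that walk. *)
by rewrite -[d]flipK src_flip -src_face_perm PsiO // (@outer_face_closed G).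
Qed.

(** * Colorings of nonzero winding *)

Section Potential.

Variables (G : mgraph) (A : {set dart G}) (w : dart G -> int) (start : vertex G -> int).
Implicit Types (p : seq (dart G)) (u v : vertex G) (d : dart G).

Fixpoint walk u p :=
  if p is d :: p' then [&& src d == u, d \in A & walk (dst d) p'] else true.

Definition walk_end u p := last u (map (@dst G) p).

Lemma walk_cat u p q : walk u (p ++ q) = walk u p && walk (walk_end u p) q.
Proof. by elim: p u => //= d p IH u; rewrite IH -!andbA. Qed.

Lemma walk_vertices u p : walk u p ->
  rcons (map (@src G) p) (walk_end u p) = u :: map (@dst G) p.
Proof.
by elim: p u => //= d p IH u /and3P[/eqP <- _ /IH] /= <-.
Qed.

Lemma walk_sub u p : walk u p -> {subset p <= A}.
Proof.
elim: p u => //= d p IH u /and3P[_ dA /IH pA] x; rewrite inE => /predU1P[-> //|].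
exact: pA.
Qed.

Lemma closed_walk_cycle u p : walk u p -> walk_end u p = u ->
  path.cycle (fun d d' => dst d == src d') p.
Proof.
case: p => //= d p /and3P[/eqP <- _]; rewrite /walk_end /= rcons_path last_map.
move=> wp ->; rewrite eqxx andbT.
by elim: p d wp => //= x p IH d /and3P[/eqP -> _ /IH ->]; rewrite eqxx.
Qed.

Hypothesis nonneg : forall c, c <> [::] -> path.cycle (fun d d' => dst d == src d') c ->
  uniq (map (@src G) c) -> {subset c <= A} -> (0 <= \sum_(d <- c) w d)%R.

(** The bound on length puts the walks in a finite type, so that a minimum exists. *)
Definition simple_walk v (up : vertex G * #|vertex G|.-bseq (dart G)) :=
  [&& walk up.1 up.2, uniq (up.1 :: map (@dst G) up.2) & walk_end up.1 up.2 == v].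

Definition weight u p : int := (start u + \sum_(d <- p) w d)%R.

Lemma simple_walk_bseq u p : uniq (u :: map (@dst G) p) -> size p <= #|vertex G|.
Proof.
by move=> /card_uniqP /= h; apply: ltnW; rewrite -(size_map (@dst G)) -h max_card.
Qed.

(* The potential is the least weight of a simple walk arriving at a vertex:
   extending such a walk by a dart either keeps it simple or closes a simple
   cycle, which may be cut off as its weight is nonnegative. *)
Lemma potential_exists : exists g : vertex G -> int,
  (forall d, d \in A -> (g (dst d) <= g (src d) + w d)%R) /\
  forall P : vertex G -> int -> Prop, (forall v, P v (start v)) ->
    (forall d z, d \in A -> P (src d) z -> P (dst d) (z + w d)%R) ->
    forall v, P v (g v).
Proof.
have sw0 v : simple_walk v (v, [bseq]) by rewrite /simple_walk /= /walk_end /= eqxx.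
pose opt v :=
  [arg min_(up < (v, [bseq] : #|vertex G|.-bseq _) | simple_walk v up) weight up.1 up.2]%O.
have optP v : simple_walk v (opt v) /\ forall u p, walk u p -> uniq (u :: map (@dst G) p) ->
    walk_end u p = v -> (weight (opt v).1 (opt v).2 <= weight u p)%R.
  rewrite /opt; case: Order.TotalTheory.arg_minP => [|[u p] swp min]; first exact: sw0.
  split=> // u' p' wp' up' ep'.
  have := min (u', Bseq (simple_walk_bseq up')); apply.
  by rewrite /simple_walk wp' up' /= ep' eqxx.
(* The value at [v] is an initial value plus the weight of a walk, so a property passed along darts
   is inherited by induction on the walk. *)
exists (fun v => weight (opt v).1 (opt v).2); split=> [d dA|P P0 Pw v]; last first.
  have [] := optP v; case: (opt v) => u p /= /and3P[wp _ /eqP <-] _.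
  elim/last_ind: (bseqval p) wp => [|q d IH]; first by rewrite /weight big_nil addr0.
  rewrite -cats1 walk_cat => /andP[/IH Pq] /= /and3P[/eqP e dA _].
  rewrite /weight big_cat big_seq1 addrA /walk_end map_cat last_cat /=.
  by apply: Pw => //; rewrite e.
have [] := optP (src d); case: (opt (src d)) => u p /= /and3P[/= wp up /eqP ep] _.
have {}up : uniq (u :: map (@dst G) p) by [].
have [_ min] := optP (dst d).
have [dp|dp] := boolP (dst d \in u :: map (@dst G) p); last first.
  have := min u (rcons p d); rewrite -cats1 walk_cat wp [walk _ [:: d]]/= ep eqxx dA => /(_ isT).
  rewrite /weight big_cat big_seq1 addrA => h; apply: h.
    by rewrite cats1 map_rcons -rcons_cons rcons_uniq dp.
  by rewrite /walk_end map_cat last_cat.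
(* The optimal walk [p] to [src d] is cut at [dst d]: [p1] ends there, and [p2] followed by [d] is a
   simple closed walk. *)
have [p1 [p2 [pE e1]]] : exists p1 p2, (p : seq _) = p1 ++ p2 /\ walk_end u p1 = dst d.
  move: dp; rewrite inE => /predU1P[->|/mapP[x xp ->]]; first by exists [::], p.
  have /splitPr[q1 q2] := xp.
  by exists (rcons q1 x), q2; rewrite cat_rcons /walk_end map_rcons last_rcons.
move: wp up ep; rewrite pE walk_cat e1 => /andP[w1 w2] up ep.
have up' : uniq (u :: map (@dst G) p1) && uniq (dst d :: map (@dst G) p2).
  move: up; rewrite map_cat -cat_cons cat_uniq => /and3P[-> /hasPn disj u2] /=.
  rewrite u2 andbT; apply/negP=> /disj /negP; apply.
  by rewrite -e1 /walk_end mem_last.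
case/andP: up' => u1 u2.
apply: (le_trans (min u p1 w1 u1 e1)).
have e2 : walk_end (dst d) p2 = src d.
  by move: ep; rewrite /walk_end map_cat last_cat -/(walk_end u p1) e1.
have w3 : walk (dst d) (rcons p2 d) by rewrite -cats1 walk_cat w2 /= e2 eqxx dA.
have := nonneg (c := rcons p2 d); rewrite /weight big_cat /=.
have -> : (\sum_(x <- rcons p2 d) w x = \sum_(x <- p2) w x + w d)%R.
  by rewrite -cats1 big_cat big_seq1.
move=> h; suff : (0 <= \sum_(x <- p2) w x + w d)%R.
  by move: (start u) (\sum_(x <- p1) w x)%R (\sum_(x <- p2) w x)%R (w d) => s1 s2 s3 s4; lia.
apply: h.
- by case: (p2).
- apply: (closed_walk_cycle w3).
  by rewrite /walk_end map_rcons last_rcons.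
- by rewrite map_rcons -e2 walk_vertices.
exact: walk_sub w3.
Qed.

End Potential.

(** * Unit flows in the dual graph *)

Section DualFlow.

Variable G : connected_plane_graph.
Implicit Types (d : dart G) (S : {set dart G}).

Notation fl := (flip G).
Notation fp := (face_perm (rotation G)).

(** Dual connectivity moves the sink: within a face nothing changes, and crossing the edge of [b]
    adds the unit chain of [b]. *)
Lemma dual_flow a b : exists delta : dart G -> int,
  (forall d, delta (fl d) = (- delta d)%R) /\
  forall S, face_closed S -> (\sum_(d in S) delta d = (a \in S)%:Z - (b \in S)%:Z)%R.
Proof.
pose P c := exists delta : dart G -> int, (forall d, delta (fl d) = (- delta d)%R) /\
  forall S, face_closed S -> (\sum_(d in S) delta d = (a \in S)%:Z - (c \in S)%:Z)%R.
rewrite -/(P b); apply: (@dart_ind_face G P _ _ a b); rewrite /P {P b}; last first.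
- by exists (fun _ => 0%R); split=> [d|S _]; rewrite ?oppr0 // big1 // subrr.
- move=> b [delta [anti sumE]]; exists delta; split=> // S fS.
  by rewrite sumE // fS.
move=> b [delta [anti sumE]]; exists (fun d => delta d + dart_chain b d)%R.
split=> [d|S fS].
  by rewrite anti /dart_chain (inj_eq perm_inj) flip_eq; lia.
have sum1 x : (\sum_(d in S) (d == x)%:Z = (x \in S)%:Z)%R.
  have [xS|xS] := boolP (x \in S).
    by rewrite (bigD1 x) //= eqxx big1 ?addr0 // => i /andP[_ /negPf ->].
  by rewrite big1 // => i iS; case: eqP => // e; rewrite -e iS in xS.
by rewrite big_split /= sumE // sumrB !sum1; lia.
Qed.

(** Flipping all darts turns the negative half of the chain into a second copy of the positive half,
    hence the factor 2. *)
Lemma sum_antisymmetric (delta : dart G -> int) (A : pred (dart G)) :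
  (forall d, delta (fl d) = (- delta d)%R) ->
  (\sum_d delta d * chain A d = 2 * \sum_(d | A d) delta d)%R.
Proof.
move=> anti.
have E (B : pred (dart G)) : (\sum_d delta d * (B d)%:Z = \sum_(d | B d) delta d)%R.
  by rewrite [RHS]big_mkcond; apply: eq_bigr => d _; case: (B d); rewrite ?mulr1 ?mulr0.
rewrite /chain; under eq_bigr do rewrite mulrBr.
rewrite sumrB [X in (_ - X)%R](reindex_inj (perm_inj (s := fl))) /= E.
under [X in (_ - X)%R]eq_bigr do rewrite flipK anti mulNr.
by rewrite sumrN E opprK mulr2n mulrDl !mul1r.
Qed.

End DualFlow.

(** * Winding of 3-colorings *)

Definition color3 (z : int) : 'I_3 := inord (absz (z %% 3)%Z).

Lemma color3E z : exists m : int, ((color3 z : nat)%:Z = z + 3 * m)%R.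
Proof.
exists (- (z %/ 3)%Z)%R; have := divz_eq z 3; have := modz_ge0 z (isT : 3 != 0 :> int)%R.
have := ltz_pmod z (isT : 0 < 3 :> int)%R; rewrite /color3 => h1 h2.
rewrite inordK; last by lia.
by lia.
Qed.

Lemma diff3 (x y z : nat) (m : int) : x < 3 -> y < 3 -> z < 3 ->
  (z%:Z = x%:Z + 1 + 3 * m)%R -> x <> y -> y <> z ->
  exists m' : int, (-1 = y%:Z - x%:Z + 3 * m')%R.
Proof.
case: x => [|[|[|]]] //; case: y => [|[|[|]]] //; case: z => [|[|[|]]] // _ _ _ e nxy nyz;
  by [exists 0%R | exists (-1)%R | exists 1%R | lia].
Qed.

Section Winding.

Variables (G : connected_plane_graph) (psi : vertex G -> 'I_3).
Hypothesis psiP : forall d, psi (src d) <> psi (dst d).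
Hypothesis quad : forall F, F \in faces G -> F <> outer_face G -> face_length F = 4.
Implicit Types (d : dart G).

Notation fl := (flip G).
Notation fp := (face_perm (rotation G)).

(** The lift to 1 or -1 of the color difference modulo 3. Its sum along a closed walk is three times
    the winding number. *)
Definition step d : int :=
  if psi (dst d) == color3 ((psi (src d) : nat)%:Z + 1)%R then 1%R else (-1)%R.

Lemma stepE d : exists m : int,
  (step d = (psi (dst d) : nat)%:Z - (psi (src d) : nat)%:Z + 3 * m)%R.
Proof.
have [m mE] := color3E ((psi (src d) : nat)%:Z + 1)%R; rewrite /step.
have ne : (psi (src d) : nat) <> psi (dst d) by move=> e; apply: (psiP (d := d)); apply: val_inj.
case: eqP => [->|/eqP ne2]; first by exists (- m)%R; rewrite mE; ring.
apply: diff3 (ltn_ord _) (ltn_ord _) (ltn_ord _) mE ne _.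
by move=> e; move/eqP: ne2; apply; apply: val_inj.
Qed.

Lemma step_cases d : step d = 1%R \/ step d = (-1)%R.
Proof. by rewrite /step; case: ifP; [left|right]. Qed.

Lemma step_flip d : step (fl d) = (- step d)%R.
Proof.
have [m mE] := stepE d; have [m' mE'] := stepE (fl d).
move: mE mE'; rewrite src_flip dst_flip.
by case: (step_cases d) => ->; case: (step_cases (fl d)) => ->; lia.
Qed.

(** The sum of four signs is even, at most 4 in absolute value and divisible by 3. *)
Lemma step_face d : d \notin outer_face G -> (\sum_(x in porbit fp d) step x = 0)%R.
Proof.
move=> dO; have [Qmem Quniq Q4] := inner_faceE quad dO.
rewrite (eq_bigl _ _ Qmem) -big_uniq //= !big_cons big_nil.
have [m0 E0] := stepE d; have [m1 E1] := stepE (fp d).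
have [m2 E2] := stepE (fp (fp d)); have [m3 E3] := stepE (fp (fp (fp d))).
move: E0 E1 E2 E3; rewrite -!src_face_perm Q4.
case: (step_cases d) => ->; case: (step_cases (fp d)) => ->;
case: (step_cases (fp (fp d))) => ->; case: (step_cases (fp (fp (fp d)))) => ->; lia.
Qed.

(** Antisymmetry makes the sum over all darts vanish, and the internal faces contribute 0. *)
Lemma step_outer : (\sum_(d in outer_face G) step d = 0)%R.
Proof.
have tot : (\sum_d step d = 0)%R.
  have : (\sum_d step d = - \sum_d step d)%R.
    rewrite {1}(reindex_inj (perm_inj (s := fl))) /= -sumrN.
    by apply: eq_bigr => d _; rewrite step_flip.
  by lia.
have inn : (\sum_(d | d \notin outer_face G) step d = 0)%R.
  rewrite (partition_big (porbit fp) [in faces G]) /=; last by move=> x _; exact: imset_f.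
  rewrite big1 // => F /imsetP[x _ ->].
  have [xO|xO] := boolP (x \in outer_face G).
    rewrite big1 // => y /andP[yO /eqP yx]; case/negP: yO.
    have xy : x \in porbit fp y by rewrite yx porbit_id.
    by rewrite -(face_closed_porbit (@outer_face_closed G) xy).
  rewrite -[RHS](step_face xO); apply: eq_bigl => y; rewrite eq_porbit_mem.
  apply: andb_idl => /(face_closed_porbit (@outer_face_closed G)) ->. by rewrite xO.
by move: tot; rewrite (bigID [in outer_face G]) /= inn addr0.
Qed.

End Winding.

Lemma closed_walk_even (G : mgraph) (kappa : vertex G -> bool) (c : seq (dart G)) :
  (forall d : dart G, kappa (dst d) = ~~ kappa (src d)) ->
  path.cycle (fun d d' => dst d == src d') c -> ~~ odd (size c).
Proof.
move=> kP; case: c => // d c.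
have E : forall x, path (fun d d' => dst d == src d') x c ->
    kappa (dst (last x c)) = kappa (src x) (+) ~~ odd (size c).
  elim: c => [|y c IH] x /=; first by rewrite kP addbT.
  by case/andP=> /eqP xy /IH ->; rewrite -xy kP; case: (kappa _); case: odd.
rewrite /= rcons_path => /andP[/E e /eqP le]; move: e; rewrite le negbK.
by case: (kappa _); case: odd.
Qed.

(** * Criticality in the absence of separating 4-cycles *)

Section Criticality.

Variables (G : connected_plane_graph) (C : seq (dart G)).
Hypotheses (cycC : is_cycle C) (sizeC : 6 <= size C) (bndC : bounds C (outer_face G)).
Hypothesis quad : forall F, F \in faces G -> F <> outer_face G -> face_length F = 4.
Hypothesis nosep : ~ (exists K : seq (dart G), separating_cycle K /\ size K = 4).
Implicit Types (d x y : dart G).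

Notation fl := (flip G).
Notation fp := (face_perm (rotation G)).

(** Lengths are even. A 4-cycle bounds a face, which is then [S], so [d0] would lie on [W]; a
    2-cycle would give parallel edges. *)
Lemma enclosing_cycle_size W S (e : int) d0 : is_cycle W -> inner S ->
  e = 1%R \/ e = (-1)%R -> (forall d, chain [in S] d = (e * chain [in W] d)%R) ->
  d0 \in S -> ~~ edge_in [in W] d0 -> 6 <= size W.
Proof.
move=> cW iS e1 SW d0S d0W.
have [kappa kP] := bipartite quad.
have [W0 cyW _ fW] := cW.
have ev := closed_walk_even kP cyW.
have s4 : size W <> 4.
  move=> s4; have [F Ff bF] := four_cycle_bounds nosep cW s4.
  have SF := bounded_region cycC sizeC bndC cW s4 Ff bF iS e1 SW.
  case/negP: d0W; have : d0 \in (face_boundary F).2 by rewrite inE -SF d0S.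
  by rewrite bF inE.
have s2 : size W <> 2.
  move=> s2; have [x [y WE]] : exists x y, W = [:: x; y].
    by case: (W) s2 => [|x [|y [|]]] // _; exists x, y.
  move: cyW; rewrite WE /= => /and3P[/eqP xy /eqP yx _].
  have pxy : parallel x (fl y) by split; rewrite ?dst_flip ?src_flip.
  have xe := no_parallel cycC sizeC bndC quad nosep pxy.
  by have := fW y; rewrite WE -xe !inE !eqxx orbT => /(_ isT).
have s0 : size W <> 0 by case: (W) W0.
by case: (W) ev s4 s2 s0 => [|?[|?[|?[|?[|?[|? ?]]]]]].
Qed.

(** If [C] were all of [G], the boundary of an internal face would be a nonzero multiple of [C].
    That face would then use at least 6 edges, but it has length 4. *)
Lemma cycle_proper : proper_subgraph (cycle_subgraph C).
Proof.
split.
  move=> d; rewrite !inE => dC; split; last by rewrite flipK orbC.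
  by apply: (edge_in_src cycC).
move=> CW.
have allC d : edge_in [in C] d.
  by move: CW => /(congr1 snd) /= /setP /(_ d); rewrite !inE.
have [S [e [iS e1 SC]]] := jordan cycC.
have [z zS] : exists z, z \in S.
  have [o _] := outer_dart G.
  have := region_cross cycC e1 SC (allC o).
  by have [|_ fo] := boolP (o \in S); [exists o|exists (fl o)].
have fzS : fl z \notin S by rewrite (region_cross cycC e1 SC (allC z)) zS.
have [fS oS] := iS.
pose F := porbit fp z.
have fF : face_closed F by exact: porbit_face_closed.
have [c cE] := chain_cycle_multiple cycC fF (fun d h => ltac:(by rewrite allC in h)).
have fzF : fl z \notin F by apply: contra fzS => /(face_closed_porbit fS) ->.
have c0 : c <> 0%R.
  by move=> c0; have := cE z; rewrite c0 mul0r /chain /= porbit_id (negPf fzF).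
have F4 : #|F| = 4.
  by apply: (card_inner_face quad); apply/negP=> /oS; rewrite zS.
(* [pick] orients each edge of [C] along [F]; injectivity gives [size C] darts in [F]. *)
pose pick d := if d \in F then d else fl d.
have pickF d : d \in C -> pick d \in F.
  move=> dC; rewrite /pick; case: ifP => // dF; apply: contraT => fdF.
  have := cE d; rewrite (cycle_chain cycC dC) mulr1 /chain /= dF (negPf fdF).
  by move=> e0; case: c0.
have pick_inj : {in C &, injective pick}.
  have [_ _ _ fC] := cycC.
  move=> x y xC yC; rewrite /pick; case: ifP => _; case: ifP => _ //.
  - by move=> xy; have := fC y yC; rewrite -xy xC.
  - by move=> xy; have := fC x xC; rewrite xy yC.
  exact: perm_inj.
have uP : uniq (map pick C) by rewrite map_inj_in_uniq // (cycle_uniq cycC).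
have : size (map pick C) <= #|F|.
  rewrite -(card_uniqP uP); apply/subset_leq_card/subsetP=> _ /mapP[x xC ->].
  exact: pickF.
by rewrite size_map F4 => /(leq_trans sizeC).
Qed.

(** The factor 6 disappears modulo 3, preserves parity, and is paid for by the length of any cycle
    around [d0]. *)
Lemma winding_coloring d0 : ~~ edge_in [in C] d0 -> exists g : vertex G -> int,
  exists delta : dart G -> int,
  [/\ forall d, d != d0 -> d != fl d0 ->
        let h := (g (dst d) - g (src d) + 6 * delta d)%R in h = 1%R \/ h = (-1)%R
    & (\sum_(d in outer_face G) delta d = -1)%R].
Proof.
move=> d0C; have [o oE] := outer_dart G.
have oO : o \in outer_face G by rewrite oE porbit_id.
have [delta [anti sumE]] := dual_flow d0 o.
have [kappa kP] := bipartite quad.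
pose A := [set d | (d != d0) && (d != fl d0)].
have Afl d : d \in A -> fl d \in A by rewrite !inE !flip_eq flipK andbC.
pose w d := (1 - 6 * delta d)%R.
have nonneg c : c <> [::] -> path.cycle (fun d d' => dst d == src d') c ->
    uniq (map (@src G) c) -> {subset c <= A} -> (0 <= \sum_(d <- c) w d)%R.
  move=> c0 cc uc cA.
  (* A closed walk along one edge and back has weight 2, since the flow cancels. *)
  have [/hasP[x xc fxc]|/hasPn nf] := boolP (has (fun x => fl x \in c) c).
    have u2 : uniq [:: x; fl x] by rewrite /= inE eq_sym flip_neq.
    have sub : {subset [:: x; fl x] <= c} by move=> z; rewrite !inE => /orP[] /eqP ->.
    have [_ mem2] := uniq_min_size u2 sub (closed_walk_flip cc uc xc fxc).
    have pc : perm_eq c [:: x; fl x].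
      by apply: uniq_perm (map_uniq uc) u2 _ => z; rewrite mem2.
    by rewrite (perm_big _ pc) /= !big_cons big_nil /w anti; lia.
  have cyc : is_cycle c by split.
  have [S [e [iS e1 Sc]]] := jordan cyc.
  (* The flow through [c] is, up to sign, the flow out of its inside: 1 if the source [d0] is there,
     else 0, as the sink is the outer face. *)
  have sumd : (\sum_(d <- c) delta d = e * (d0 \in S)%:Z)%R.
    have := sum_antisymmetric [in c] anti; have := sum_antisymmetric [in S] anti.
    rewrite (eq_bigr (fun d => e * (delta d * chain [in c] d))%R); last first.
      by move=> d _; rewrite Sc mulrCA.
    rewrite -mulr_sumr sumE ?iS.1 //; last by case: iS.
    rewrite (negPf (iS.2 o oO)) subr0 (big_uniq _ (map_uniq uc)) /= => E1 E2.
    by move: E1; rewrite E2; case: e1 => ->; move: (\sum_(i in c) _)%R => s; case: (d0 \in S); lia.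
  have -> : (\sum_(d <- c) w d = (size c)%:Z - 6 * \sum_(d <- c) delta d)%R.
    rewrite /w sumrB -mulr_sumr; congr (_ - _)%R.
    by rewrite -[RHS]natz -sum1_size natr_sum.
  rewrite sumd; have [d0S|d0S] := boolP (d0 \in S); last by rewrite mulr0; lia.
  have d0c : ~~ edge_in [in c] d0.
    by rewrite negb_or; apply/andP; split; apply/negP=> /cA; rewrite !inE !eqxx ?andbF.
  have := enclosing_cycle_size cyc iS e1 Sc d0S d0c.
  by case: e1 => ->; lia.
(* Starting from [kappa] fixes parity: all weights are odd, and each dart changes sides. *)
have [g [gw gP]] := potential_exists (fun v => (kappa v : nat)%:Z%R) nonneg.
exists g, delta; split; last first.
  rewrite sumE; last exact: outer_face_closed.
  rewrite oO; have : ~~ edge_in [in outer_face G] d0 by rewrite (edge_in_outer bndC).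
  by rewrite negb_or => /andP[/= /negPf -> _].
have par v : exists m : int, (g v = (kappa v : nat)%:Z + 2 * m)%R.
  apply: (gP (fun v z => exists m : int, (z = (kappa v : nat)%:Z + 2 * m)%R)).
    by move=> u; exists 0%R; rewrite mulr0 addr0.
  move=> d z dA [m ->]; rewrite kP /w; case: (kappa _) => /=.
    by exists (m + 1 - 3 * delta d)%R; lia.
  by exists (m - 3 * delta d)%R; lia.
(* The potential inequalities for [d] and [fl d] bound the value by 1 in absolute value, and parity
   makes it odd. *)
move=> d n1 n2 /=.
have dA : d \in A by rewrite inE n1.
have := gw d dA; have := gw (fl d) (Afl d dA).
rewrite /w src_flip dst_flip anti.
have [m1 ->] := par (src d); have [m2 ->] := par (dst d); rewrite kP.
move: (delta d) => D; case: (kappa _) => /=; lia.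
Qed.

(** A proper subgraph misses an edge [d0], because every vertex carries a dart. The coloring [g]
    modulo 3 obtained for [d0] then serves for every [H] avoiding that edge. *)
Lemma no_separating_critical : critical (cycle_subgraph C).
Proof.
split; first exact: cycle_proper.
move=> H [sH nH] [CH1 CH2].
have [d0 d0H] : exists d0, d0 \notin H.2.
  apply/existsP; rewrite -negb_forall; apply/negP=> /forallP allH; apply: nH.
  case: H sH allH {CH1 CH2} => H1 H2 /= sH allH; congr (_, _); apply/setP=> v; rewrite inE.
    by have [d <-] := vertex_dart v; have [] := sH d (allH d).
  by rewrite allH.
have fd0H : fl d0 \notin H.2 by apply: contra d0H => /sH[_]; rewrite flipK.
have edgeC d : edge_in [in C] d -> d \in H.2.
  by move=> dC; apply: (subsetP CH2); rewrite inE.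
have d0C : ~~ edge_in [in C] d0 by apply: contra d0H; exact: edgeC.
have [g [delta [gstep sumd]]] := winding_coloring d0C.
have gH d : d \in H.2 ->
    let h := (g (dst d) - g (src d) + 6 * delta d)%R in h = 1%R \/ h = (-1)%R.
  by move=> dH; apply: gstep; [apply: contraNneq d0H | apply: contraNneq fd0H] => <-.
pose phi v := color3 (g v).
have phiH : proper_coloring H phi.
  move=> d dH e; have := gH d dH.
  have [m1] := color3E (g (src d)); have [m2] := color3E (g (dst d)).
  rewrite -/(phi _) -/(phi _) e => -> /=.
  by move: (delta d) => D; lia.
exists phi; split; first by move=> d; rewrite inE => /edgeC /phiH.
  by exists phi.
move=> [psi [psiP psiC]].
have {}psiP d : psi (src d) <> psi (dst d) by apply: psiP; rewrite inE.
(* On [C] the colorings agree, so both sides are congruent modulo 3; being 1 or -1, they are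
   equal. *)
have stepO d : d \in outer_face G -> step psi d = (g (dst d) - g (src d) + 6 * delta d)%R.
  move=> dO; have dC : edge_in [in C] d by rewrite -(edge_in_outer bndC) /edge_in /= dO.
  have sC : psi (src d) = phi (src d) by apply: psiC; rewrite inE (edge_in_src cycC).
  have tC : psi (dst d) = phi (dst d).
    by apply: psiC; rewrite inE -src_flip (edge_in_src cycC) // edge_in_flip.
  have [m1 E1] := color3E (g (src d)); have [m2 E2] := color3E (g (dst d)).
  have [m] := stepE psiP d; rewrite sC tC /phi E1 E2.
  have := gH d (edgeC d dC) => /=.
  move: (delta d) => D.
  by case: (step_cases psi d) => ->; lia.
(* Around the outer face the differences of [g] telescope and the flow contributes -6, whereas the
   winding of [psi] is 0. *)
have := step_outer psiP quad; rewrite (eq_bigr _ stepO) big_split /= -mulr_sumr sumd sumrB.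
have -> : (\sum_(d in outer_face G) g (dst d) = \sum_(d in outer_face G) g (src d))%R.
  rewrite -(sum_face_permutation (fun d => g (src d)) (@outer_face_closed G)).
  by apply: eq_bigr => d _; rewrite src_face_perm.
by rewrite subrr add0r.
Qed.

End Criticality.

Theorem theorem8 (G : connected_plane_graph) (k : nat) (C : seq (dart G)) :
  triangle_free G ->
  is_cycle C -> size C = k -> 6 <= k ->
  bounds C (outer_face G) ->
  (forall F, F \in faces G -> F <> outer_face G -> face_length F = 4) ->
  critical (cycle_subgraph C) <->
    ~ (exists K : seq (dart G), separating_cycle K /\ size K = 4).
Proof.
move=> _ cC <- sC bC quad; split; first exact: critical_no_separating.
exact: no_separating_critical.
Qed.
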